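(* Let $n\ge1$ be an integer and $s>0$. (i) The spectral fractional-logarithmic Sobolev space $H^{2s+\mathrm{Log}}(\mathbb{R}^n)$ admits the characterization $$H^{2s+\mathrm{Log}}(\mathbb{R}^n)=\Bigl\{u\in L^2(\mathbb{R}^n):\int_{\mathbb{R}^n}|\xi|^{4s}\ln^2(|\xi|^2)\,|\widehat u(\xi)|^2\,d\xi<\infty\Bigr\}.$$ (ii) For every $u\in H^{2s+\mathrm{Log}}(\mathbb{R}^n)$, $(-\Delta)^{s+\mathrm{Log}}u$ is well-defined as an $L^2(\mathbb{R}^n)$ function and satisfies $$(-\Delta)^{s+\mathrm{Log}}u=\mathcal{F}^{-1}\Bigl(|\xi|^{2s}\ln(|\xi|^2)\,\widehat u(\xi)\Bigr)\quad\text{in }L^2(\mathbb{R}^n).$$ Moreover, $$\|(-\Delta)^{s+\mathrm{Log}}u\|_{L^2(\mathbb{R}^n)}^2=\int_{\mathbb{R}^n}|\xi|^{4s}\ln^2(|\xi|^2)\,|\widehat u(\xi)|^2\,d\xi.$$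
   Context: Let $-\Delta=\int_{[0,\infty)}\lambda\,dE(\lambda)$ be the spectral resolution of the nonnegative self-adjoint Laplacian on $L^2(\mathbb{R}^n)$, and $E_{u,v}(B)=\langle E(B)u,v\rangle_{L^2}$ for Borel $B\subset[0,\infty)$. The operator $(-\Delta)^{s+\mathrm{Log}}$ is here the one given by the functional calculus, $(-\Delta)^{s+\mathrm{Log}}=\int_{(0,\infty)}\lambda^s\ln\lambda\,dE(\lambda)$, i.e. $\langle(-\Delta)^{s+\mathrm{Log}}u,v\rangle_{L^2}=\int_{(0,\infty)}\lambda^s\ln\lambda\,dE_{u,v}(\lambda)$ for $v\in L^2(\mathbb{R}^n)$ and $u$ in the domain $H^{2s+\mathrm{Log}}(\mathbb{R}^n):=\{u\in L^2(\mathbb{R}^n):\int_{(0,\infty)}\lambda^{2s}\ln^2\lambda\,dE_{u,u}(\lambda)<\infty\}$. The Fourier transform is $\mathcal{F}[u](\xi)=\widehat u(\xi)=(2\pi)^{-n/2}\int_{\mathbb{R}^n}e^{-i\xi\cdot x}u(x)\,dx$, extended to a unitary operator on $L^2(\mathbb{R}^n)$. *)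

(* Defs.v *)
From HB Require Import structures.
From mathcomp Require Import all_boot all_order all_algebra.
From mathcomp Require Import complex.
From mathcomp Require Import all_classical all_reals all_analysis.

Set Implicit Arguments.
Unset Strict Implicit.
Unset Printing Implicit Defensive.
Import Order.TTheory GRing.Theory Num.Theory.
Import numFieldNormedType.Exports.

Local Open Scope classical_set_scope.
Local Open Scope ring_scope.

Definition rV_display : measure_display. Proof. by constructor. Qed.

Section rV_measurable.
Context {R : realType} {n : nat}.

Let coord (i : 'I_n) (v : 'rV[R]_n) : measurableTypeR R := v ord0 i.

Let rV_set0 : g_sigma_preimage coord set0.
Proof. exact: sigma_algebra0. Qed.

Let rV_setC A : g_sigma_preimage coord A -> g_sigma_preimage coord (~` A).
Proof. exact: sigma_algebraC. Qed.

Let rV_bigcup (F : _^nat) : (forall i, g_sigma_preimage coord (F i)) ->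
  g_sigma_preimage coord (\bigcup_i (F i)).
Proof. exact: sigma_algebra_bigcup. Qed.

HB.instance Definition _ := @isMeasurable.Build rV_display 'rV[R]_n
  (g_sigma_preimage coord) rV_set0 rV_setC rV_bigcup.

Lemma measurable_rV_coord (i : 'I_n) :
  measurable_fun [set: 'rV[R]_n] (fun v => v ord0 i : measurableTypeR R).
Proof.
move=> _ Y mY; rewrite setTI; apply: sub_sigma_algebra => /=.
rewrite -bigcup_seq/=; exists i => /=; first by rewrite mem_index_enum.
by exists Y => //; rewrite setTI.
Qed.

Lemma measurable_fun_rV d (T : measurableType d) (f : T -> 'rV[R]_n) :
  (forall i, measurable_fun [set: T] (fun x => f x ord0 i : measurableTypeR R)) ->
  measurable_fun [set: T] f.
Proof.
move=> mf.
suff : g_sigma_preimage (fun i x => coord i (f x)) `<=` measurable.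
  rewrite (@g_sigma_preimage_comp _ _ n _ coord _ f) => h _ A mA.
  by apply: h; exists A.
apply: smallest_sub; first exact: sigma_algebra_measurable.
rewrite -bigcup_seq; apply: bigcup_sub => i _ _ [B mB <-].
exact: mf.
Qed.

End rV_measurable.

Section lebesgue_rcons.
Context {R : realType} {n : nat}.

Definition rV_cons (p : measurableTypeR R * 'rV[R]_n) : 'rV[R]_n.+1 :=
  \row_i if unlift ord0 i is Some j then p.2 ord0 j else p.1.

Lemma rV_cons0 p : rV_cons p ord0 ord0 = p.1.
Proof. by rewrite mxE unlift_none. Qed.

Lemma rV_consS p i : rV_cons p ord0 (lift ord0 i) = p.2 ord0 i.
Proof. by rewrite mxE liftK. Qed.

Lemma measurable_rV_cons : measurable_fun setT rV_cons.
Proof.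
apply: measurable_fun_rV => i.
have [->|[j ->]] : i = ord0 \/ exists j, i = lift ord0 j.
- by case: (unliftP ord0 i) => [j ->|->]; [right; exists j|left].
- rewrite (_ : (fun _ => _) = fst); first exact: measurable_fst.
  by apply/funext => p; exact: rV_cons0.
- rewrite (_ : (fun _ => _) =
    (fun v : 'rV[R]_n => v ord0 j : measurableTypeR R) \o snd).
    apply: measurableT_comp; [exact: measurable_rV_coord|exact: measurable_snd].
  by apply/funext => p; exact: rV_consS.
Qed.

Definition rV_uncons (v : 'rV[R]_n.+1) : measurableTypeR R * 'rV[R]_n :=
  (v ord0 ord0, \row_i v ord0 (lift ord0 i)).

Lemma rV_consK : cancel rV_cons rV_uncons.
Proof.
move=> p; rewrite /rV_uncons rV_cons0 [RHS]surjective_pairing; congr pair.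
by apply/rowP => i; rewrite mxE rV_consS.
Qed.

Lemma measurable_rV_uncons : measurable_fun setT rV_uncons.
Proof.
apply/measurable_fun_pairP; split; first exact: measurable_rV_coord.
apply: measurable_fun_rV => i.
rewrite (_ : (fun _ => _) = fun v : 'rV[R]_n.+1 =>
  v ord0 (lift ord0 i) : measurableTypeR R); first exact: measurable_rV_coord.
by apply/funext => v; rewrite /= mxE.
Qed.

Variable mu : {sigma_finite_measure set 'rV[R]_n -> \bar R}.

Definition lebesgue_step : set 'rV[R]_n.+1 -> \bar R :=
  pushforward (@lebesgue_measure R \x mu)%E rV_cons.

Let measurable_preimage_cons A :
  measurable A -> measurable (rV_cons @^-1` A).
Proof. by move=> mA; rewrite -[X in measurable X]setTI; exact: measurable_rV_cons. Qed.

Let lebesgue_step0 : (lebesgue_step set0 = 0)%E.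
Proof. by rewrite /lebesgue_step /pushforward preimage_set0 measure0. Qed.

Let lebesgue_step_ge0 A : (0 <= lebesgue_step A)%E.
Proof. exact: (measure_ge0 (@lebesgue_measure R \x mu)%E). Qed.

Let lebesgue_step_additive : semi_sigma_additive lebesgue_step.
Proof.
move=> F mF tF mUF; rewrite /lebesgue_step /pushforward preimage_bigcup.
apply: measure_semi_sigma_additive => [k||].
- exact: measurable_preimage_cons.
- apply/trivIsetP => /= i j _ _ ij; rewrite -preimage_setI.
  by move/trivIsetP : tF => /(_ _ _ _ _ ij) ->//; rewrite preimage_set0.
- by rewrite -preimage_bigcup; exact: measurable_preimage_cons.
Qed.

HB.instance Definition _ := isMeasure.Build _ _ _ lebesgue_step
  lebesgue_step0 lebesgue_step_ge0 lebesgue_step_additive.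

Let lebesgue_step_sigma_finite : sigma_finite setT lebesgue_step.
Proof.
have /sigma_finiteP[A [TA ndA Aoo]] := sigma_finiteT (@lebesgue_measure R).
have /sigma_finiteP[B [TB ndB Boo]] := sigma_finiteT mu.
exists (fun k => rV_uncons @^-1` (A k `*` B k)).
  rewrite -preimage_bigcup (_ : \bigcup_k _ = setT) ?preimage_setT//.
  rewrite -setXTT TA TB predeqE => -[x y]; split.
    by move=> [k _ []/= ? ?]; split; exists k.
  move=> [/= [k _ Akx] [l _ Bly]]; exists (maxn k l) => //; split.
  - by move: x Akx; exact/subsetPset/ndA/leq_maxl.
  - by move: y Bly; exact/subsetPset/ndB/leq_maxr.
move=> k; have [mA Ak] := Aoo k; have [mB Bk] := Boo k.
split.
  rewrite -[X in measurable X]setTI.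
  by apply: measurable_rV_uncons => //; exact: measurableX.
rewrite /lebesgue_step /pushforward -comp_preimage.
rewrite (_ : rV_uncons \o rV_cons = id); last first.
  by apply/funext => p /=; rewrite rV_consK.
by rewrite preimage_id product_measure1E// lte_mul_pinfty// ge0_fin_numE.
Qed.

HB.instance Definition _ := Measure_isSigmaFinite.Build _ _ _ lebesgue_step
  lebesgue_step_sigma_finite.

End lebesgue_rcons.

(* Lebesgue measure on R^n, on the Borel sets: the n-fold product of
   lebesgue_measure. *)
Fixpoint leb {R : realType} (n : nat) :
    {sigma_finite_measure set 'rV[R]_n -> \bar R} :=
  if n is n'.+1 then lebesgue_step (leb n') else dirac (0 : 'rV[R]_0).

(* Complex-valued functions on R^n. Elements of L^2 are represented by Borel
   functions and L^2-equality is equality almost everywhere. *)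

Local Open Scope complex_scope.

Section L2.
Context {R : realType} {n : nat}.
Implicit Types (u v w : 'rV[R]_n -> R[i]).

Definition ae_equal u v : Prop := {ae leb n, forall x, u x = v x}.

Definition cmeasurable u : Prop :=
  measurable_fun setT (fun x => complex.Re (u x)) /\
  measurable_fun setT (fun x => complex.Im (u x)).

Definition L1 : set ('rV[R]_n -> R[i]) :=
  [set u | cmeasurable u /\ (\int[leb n]_x (Normc.normc (u x))%:E < +oo)%E].

Definition L2 : set ('rV[R]_n -> R[i]) :=
  [set u | cmeasurable u /\ (\int[leb n]_x (Normc.normc (u x) ^+ 2)%:E < +oo)%E].

Definition cintegral u : R[i] :=
  (\int[leb n]_x complex.Re (u x)) +i* (\int[leb n]_x complex.Im (u x)).

Definition inner u v : R[i] := cintegral (fun x => u x * (v x)^*).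

Definition sqnorm u : \bar R := (\int[leb n]_x (Normc.normc (u x) ^+ 2)%:E)%E.

(* A map on functions that induces an everywhere defined linear operator on the
   space of almost-everywhere classes. *)
Record linear_on_L2 (T : ('rV[R]_n -> R[i]) -> 'rV[R]_n -> R[i]) : Prop := {
  lin_L2 : forall u, L2 u -> L2 (T u);
  lin_ae : forall u v, L2 u -> L2 v -> ae_equal u v -> ae_equal (T u) (T v);
  lin_lin : forall a u v, L2 u -> L2 v ->
    ae_equal (T (fun x => a * u x + v x)) (fun x => a * T u x + T v x)
}.

End L2.

Section fourier.
Context {R : realType} {n : nat}.
Implicit Types (u v g : 'rV[R]_n -> R[i]) (x xi : 'rV[R]_n).

Definition dot xi x : R := \sum_(i < n) xi ord0 i * x ord0 i.

(* Euclidean norm; the library norm `|xi| on row vectors is the sup norm. *)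
Definition enorm xi : R := Num.sqrt (dot xi xi).

Definition expi (t : R) : R[i] := cos t +i* sin t.

Definition fourier_integral u xi : R[i] :=
  ((2 * pi) `^ (- (n%:R / 2)))%:C *
  cintegral (fun x => expi (- dot xi x) * u x).

(* F is the unitary operator on L^2 extending the integral formula, and Finv
   its inverse. These conditions determine both up to almost-everywhere
   equality, since L^1 /\ L^2 is dense in L^2. *)
Record unitary_fourier
    (F Finv : ('rV[R]_n -> R[i]) -> 'rV[R]_n -> R[i]) : Prop := {
  fourier_linear : linear_on_L2 F;
  fourier_inv_linear : linear_on_L2 Finv;
  fourier_inner : forall u v, L2 u -> L2 v -> inner (F u) (F v) = inner u v;
  fourierK : forall u, L2 u -> ae_equal (Finv (F u)) u;
  fourierVK : forall g, L2 g -> ae_equal (F (Finv g)) g;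
  fourierE : forall u, L1 u -> L2 u -> ae_equal (F u) (fourier_integral u)
}.

End fourier.

Section laplacian.
Context {R : realType} {n : nat}.
Implicit Types (phi : 'rV[R]_n -> R) (u f : 'rV[R]_n -> R[i]).

Definition partial (i : 'I_n) phi : 'rV[R]_n -> R :=
  fun x => 'D_(delta_mx ord0 i) phi x.

Definition smooth phi : Prop := forall s : seq 'I_n,
  let g := foldr partial phi s in
  continuous g /\ forall i x, derivable g x (delta_mx ord0 i).

Definition test_function phi : Prop := smooth phi /\
  exists2 K : set 'rV[R]_n, compact K & forall x, ~ K x -> phi x = 0.

Definition laplacian phi : 'rV[R]_n -> R :=
  fun x => \sum_(i < n) partial i (partial i phi) x.

(* The graph of -Delta with its self-adjoint domain
   H^2(R^n) = {u in L^2 : Delta u in L^2}, Delta u in the distribution sense. *)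
Definition neg_laplacian u f : Prop :=
  [/\ L2 u, L2 f & forall phi, test_function phi ->
    cintegral (fun x => u x * (- laplacian phi x)%:C) =
    cintegral (fun x => f x * (phi x)%:C)].

End laplacian.

Section spectral.
Context {R : realType} {n : nat}.
Implicit Types (u v w : 'rV[R]_n -> R[i]) (A B D : set (measurableTypeR R)).
Implicit Types (g h : R -> R).

Definition halfline : set (measurableTypeR R) := `[0%R, +oo[%classic.

(* Only the values E B for Borel sets B of [0, +oo[ are constrained. *)
Record spectral_measure
    (E : set R -> ('rV[R]_n -> R[i]) -> 'rV[R]_n -> R[i]) : Prop := {
  spec_linear : forall B, measurable B -> B `<=` halfline ->
    linear_on_L2 (E B);
  spec_selfadjoint : forall B u v, measurable B -> B `<=` halfline ->
    L2 u -> L2 v -> inner (E B u) v = inner u (E B v);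
  spec_setI : forall A B u, measurable A -> A `<=` halfline ->
    measurable B -> B `<=` halfline -> L2 u ->
    ae_equal (E (A `&` B) u) (E A (E B u));
  spec_setT : forall u, L2 u -> ae_equal (E halfline u) u;
  spec_additive : forall (B : (set (measurableTypeR R))^nat) u,
    (forall k, measurable (B k)) -> (forall k, B k `<=` halfline) ->
    trivIset setT B -> L2 u ->
    sqnorm (fun x => E (\bigcup_k B k) u x - \sum_(k < N) E (B k) u x)
      @[N --> \oo] --> 0%E
}.

Variable E : set R -> ('rV[R]_n -> R[i]) -> 'rV[R]_n -> R[i].

(* E_{u,v}, as a complex measure on R carried by [0, +oo[. *)
Definition spec_form u v B : R[i] := inner (E (B `&` halfline) u) v.

(* \int_D h d(E_{u,u}) for h >= 0. E_{u,u} is real-valued and nonnegative for a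
   spectral measure; the library integral is defined for any set function. *)
Definition spec_energy u D h : \bar R :=
  (\int[fun B : set (measurableTypeR R) =>
          (complex.Re (spec_form u u B))%:E]_(x in D) (h x)%:E)%E.

(* g is integrable over D for the complex measure nu, with integral z. Any
   decomposition of nu into positive finite measures integrating g gives the
   same z, and one exists iff g is integrable for the total variation of nu
   (take the Jordan decompositions of the real and imaginary parts). *)
Definition has_cintegral (nu : set (measurableTypeR R) -> R[i])
    D g (z : R[i]) : Prop :=
  exists a b c d : {finite_measure set (measurableTypeR R) -> \bar R},
  [/\ forall B, measurable B ->
        nu B = (fine (a B) - fine (b B)) +i* (fine (c B) - fine (d B)),
      a.-integrable D (EFin \o g) /\ b.-integrable D (EFin \o g),
      c.-integrable D (EFin \o g) /\ d.-integrable D (EFin \o g) &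
      z = (\int[a]_(x in D) g x - \int[b]_(x in D) g x) +i*
          (\int[c]_(x in D) g x - \int[d]_(x in D) g x)].

(* w = (\int_D g dE) u, tested against all of L^2 *)
Definition spec_integral D g u w : Prop :=
  [/\ L2 u, L2 w &
      forall v, L2 v -> has_cintegral (spec_form u v) D g (inner w v)].

(* -Delta = \int_[0, +oo[ x dE(x), domains included *)
Definition spectral_resolution : Prop :=
  spectral_measure E /\
  forall u f, neg_laplacian u f <->
    (spec_energy u halfline (fun x => (x ^+ 2)%R) < +oo)%E /\
    spec_integral halfline id u f.

Definition H_fraclog (s : R) : set ('rV[R]_n -> R[i]) :=
  [set u | L2 u /\
    (spec_energy u `]0%R, +oo[%classic
       (fun x => (x `^ (2 * s) * ln x ^+ 2)%R) < +oo)%E].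

(* w = (-Delta)^(s + Log) u, as the graph of a relation on L^2 *)
Definition fraclog (s : R) u w : Prop :=
  H_fraclog s u /\
  spec_integral `]0%R, +oo[%classic (fun x => x `^ s * ln x) u w.

End spectral.

(* Main.v *)
Require Import Defs.
From HB Require Import structures.
From mathcomp Require Import all_boot all_order all_algebra.
From mathcomp Require Import complex.
From mathcomp Require Import all_classical all_reals all_analysis.
From mathcomp Require Import measurable_realfun ring lra.
Import Order.TTheory GRing.Theory Num.Theory.
Import numFieldNormedType.Exports.

Set Implicit Arguments.
Unset Strict Implicit.
Unset Printing Implicit Defensive.

Local Open Scope classical_set_scope.
Local Open Scope ring_scope.
Local Open Scope complex_scope.

(** Only one inclusion between -Delta and multiplication by |xi|^2 is needed:
    integrating by parts against test functions, every u in L^2 with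
    |xi|^2 F u in L^2 lies in the domain of -Delta, with F(-Delta u) = |xi|^2 F u.
    This already determines the resolution E. Put G_B = F E_B F^-1. If g is
    supported in |xi|^2 <= a and A lies in [b, +oo[ with a < b, then
      b^(2k) |G_A g|^2 <= |G_A (|xi|^(2k) g)|^2 <= a^(2k) |g|^2   for all k,
    so G_A g = 0; symmetrically with |xi|^(-2k) when g is supported in
    |xi|^2 > a and A lies in [0, c] with c < a. Hence G_B is multiplication by
    the indicator of {|xi|^2 in B}, first for rays and then for Borel sets. So
    the measures E_{u,v} are the images under |xi|^2 of (F u)(F v)^* dxi, and
    both parts follow by changing variables. *)

(** * Integrals against complex measures *)

(** The resolution is given only weakly, by [<-Delta u, v> = \int x dE_{u,v}], and [has_cintegral]
    accepts any decomposition of E_{u,v} into finite measures, not only the Jordan one. Integrals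
    are therefore compared through the values of the set functions on Borel sets. Bounds on |G_A
    (|xi|^2 g)| come from testing against G_A g, because E_{g, G_A g} is a positive measure carried
    by A, and then applying Cauchy-Schwarz. A single such step gives only |G_A g| <= (a/b) |g|.
    Multiplying g by a power of |xi|^2 does not enlarge its support, so the step can be repeated and
    the ratio becomes (a/b)^k. That one inclusion suffices reflects a general fact: multiplication
    by |xi|^2 on its maximal domain is self-adjoint, hence has no proper self-adjoint extension. *)

Section setfun_integral.
Context d (T : measurableType d) (R : realType).
Implicit Types (D : set T) (f : T -> \bar R).
Local Open Scope ereal_scope.
Import HBNNSimple.

Let nnsfun_level D f (h : {nnsfun T >-> R}) (r : R) :
  (forall x, (h x)%:E <= (f \_ D) x) -> r != 0%R -> h @^-1` [set r] `<=` D.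
Proof.
move=> hfD r0 x /= hx; have := hfD x; rewrite /patch; case: ifPn => [/set_mem//|_].
by rewrite hx lee_fin leNgt lt_neqAle eq_sym r0 -hx fun_ge0.
Qed.

(** A nonnegative simple function below f restricted to D vanishes off D, so only the value 0 can
    have a level set leaving D, and that term contributes nothing. *)
Lemma le_measure_integral_subset (m1 m2 : {measure set T -> \bar R}) D f :
  (forall B, measurable B -> B `<=` D -> m1 B <= m2 B) ->
  (forall x, D x -> 0 <= f x) ->
  \int[m1]_(x in D) f x <= \int[m2]_(x in D) f x.
Proof.
move=> m12 f0; rewrite !ge0_integralE //= ge_ereal_sup// => _ [h/= hfD <-].
apply: le_ereal_sup_tmp; exists (sintegral m2 h); first by exists h.
rewrite !sintegralE lee_fsum// => r [t _ htr].
have [->|rn0] := eqVneq r 0%R; first by rewrite !mul0e.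
by rewrite lee_wpmul2l ?lee_fin -?htr// m12// htr; exact: nnsfun_level hfD rn0.
Qed.

(* Unlike [eq_measure_integral], this covers set functions that are measures
   only once restricted to measurable sets, such as the one in [spec_energy]. *)
Lemma eq_setfun_integral (m1 m2 : set T -> \bar R) D f :
  (forall B, measurable B -> B `<=` D -> m1 B = m2 B) ->
  \int[m1]_(x in D) f x = \int[m2]_(x in D) f x.
Proof.
move=> m12; rewrite /integral funepos_restrict funeneg_restrict.
have sE (g : T -> \bar R) (h : {nnsfun T >-> R}) :
    (forall x, (h x)%:E <= (g \_ D) x) -> sintegral m1 h = sintegral m2 h.
  move=> hgD; apply: eq_fsbigr => r _.
  have [->|rn0] := eqVneq r 0%R; first by rewrite !mul0e.
  by rewrite m12//; exact: nnsfun_level hgD rn0.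
by congr (ereal_sup _ - ereal_sup _); apply/seteqP; split => _ [h hf <-];
  exists h => //; rewrite (sE _ _ hf).
Qed.

End setfun_integral.

Section has_cintegral_theory.
Context {R : realType}.
Implicit Types (nu : set (measurableTypeR R) -> R[i]) (D : set (measurableTypeR R)).
Implicit Types (g : R -> R) (z : R[i]).
Local Notation T := (measurableTypeR R).

Lemma Rintegral_measure_add (a b : {finite_measure set T -> \bar R}) D g :
  measurable D -> a.-integrable D (EFin \o g) -> b.-integrable D (EFin \o g) ->
  \int[measure_add a b]_(x in D) g x = \int[a]_(x in D) g x + \int[b]_(x in D) g x.
Proof.
move=> mD ia ib; rewrite /Rintegral.
rewrite integral_measure_add//.
by rewrite fineD//; exact: integrable_fin_num.
Qed.

(** Rearranged as [a + b'] against [a' + b], the hypothesis says that two positive measures agree on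
    the measurable subsets of D. No Jordan decomposition is involved. *)
Lemma Rintegral_diff_uniq (a b a' b' : {finite_measure set T -> \bar R}) D g :
  measurable D ->
  a.-integrable D (EFin \o g) -> b.-integrable D (EFin \o g) ->
  a'.-integrable D (EFin \o g) -> b'.-integrable D (EFin \o g) ->
  (forall B, measurable B -> B `<=` D ->
    fine (a B) - fine (b B) = fine (a' B) - fine (b' B)) ->
  \int[a]_(x in D) g x - \int[b]_(x in D) g x =
  \int[a']_(x in D) g x - \int[b']_(x in D) g x.
Proof.
move=> mD ia ib ia' ib' h.
apply/eqP; rewrite subr_eq addrAC eq_sym subr_eq; apply/eqP.
rewrite -!Rintegral_measure_add// /Rintegral; congr fine.
apply: eq_measure_integral => B mB BD.
rewrite [LHS](measure_addE a' b B) [RHS](measure_addE a b' B).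
have fE (m : {finite_measure set T -> \bar R}) : m B = (fine (m B))%:E.
  by rewrite fineK ?fin_num_measure.
have := h _ mB BD; have := fE a; have := fE b; have := fE a'; have := fE b'.
move=> /= -> -> -> -> /= H; rewrite -!EFinD; congr EFin; lra.
Qed.

Lemma has_cintegral_uniq nu nu' D g z z' : measurable D ->
  (forall B, measurable B -> B `<=` D -> nu B = nu' B) ->
  has_cintegral nu D g z -> has_cintegral nu' D g z' -> z = z'.
Proof.
move=> mD eq_nu [a [b [c [d [nuE [ia ib] [ic id] ->]]]]].
move=> [a' [b' [c' [d' [nuE' [ia' ib'] [ic' id'] ->]]]]].
have h B : measurable B -> B `<=` D -> fine (a B) - fine (b B) = fine (a' B) - fine (b' B)
  /\ fine (c B) - fine (d B) = fine (c' B) - fine (d' B).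
  by move=> mB BD; have := eq_nu _ mB BD; rewrite nuE// nuE'// => -[].
congr (_ +i* _); apply: Rintegral_diff_uniq => // B mB BD; by have [] := h _ mB BD.
Qed.

Lemma has_cintegral0 nu D g z : measurable D ->
  (forall B, measurable B -> B `<=` D -> nu B = 0) ->
  has_cintegral nu D g z -> z = 0.
Proof.
move=> mD nu0 [a [b [c [d [nuE [ia ib] [ic id] ->]]]]].
have h B : measurable B -> B `<=` D -> fine (a B) = fine (b B)
  /\ fine (c B) = fine (d B).
  move=> mB BD; have := nu0 _ mB BD; rewrite nuE// => -[/eqP + /eqP].
  by rewrite !subr_eq0 => /eqP -> /eqP ->.
rewrite (Rintegral_diff_uniq (a' := b) (b' := b))//; last first.
  by move=> B mB BD; rewrite (h _ mB BD).1.
rewrite (Rintegral_diff_uniq (a := c) (b := d) (a' := d) (b' := d))//; last first.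
  by move=> B mB BD; rewrite (h _ mB BD).2.
by rewrite !subrr.
Qed.

Lemma has_cintegral_Im0 nu D g z : measurable D ->
  (forall B, measurable B -> B `<=` D -> complex.Im (nu B) = 0) ->
  has_cintegral nu D g z -> complex.Im z = 0.
Proof.
move=> mD nu0 [a [b [c [d [nuE [ia ib] [ic id] ->]]]]] /=.
rewrite (Rintegral_diff_uniq (a' := d) (b' := d))// ?subrr// => B mB BD.
by have := nu0 _ mB BD; rewrite nuE//= => ->; rewrite subrr.
Qed.

(* A decomposition nu = a - b of a nonnegative nu satisfies b <= a setwise, so
   [\int (g - c) da - \int (g - c) db >= 0] wherever g >= c. *)
Lemma has_cintegral_ge nu D D' g c z : measurable D -> measurable D' ->
  D' `<=` D ->
  (forall B, measurable B -> B `<=` D -> 0 <= complex.Re (nu B)) ->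
  (forall B, measurable B -> B `<=` D `\` D' -> complex.Re (nu B) = 0) ->
  (forall x, D' x -> c <= g x) ->
  has_cintegral nu D g z -> c * complex.Re (nu D) <= complex.Re z.
Proof.
move=> mD mD' D'D nu_ge0 nu0 cg [a [b [e [f [nuE [ia ib] _ ->]]]]] /=.
have mDD' : measurable (D `\` D') by exact: measurableD.
have DE : D = (D `\` D') `|` D' by rewrite setUC setDUK.
have disj : [disjoint D `\` D' & D'] by apply/disj_setPS => x [[_]].
have DD'D : D `\` D' `<=` D by move=> x [].
have iS (m : {finite_measure set T -> \bar R}) : m.-integrable D (EFin \o g) ->
    m.-integrable D' (EFin \o g) /\ m.-integrable (D `\` D') (EFin \o g).
  by move=> im; split; apply: integrableS im.
have [ia' ia''] := iS _ ia; have [ib' ib''] := iS _ ib.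
have splitI (m : {finite_measure set T -> \bar R}) : m.-integrable D (EFin \o g) ->
    \int[m]_(x in D) g x = \int[m]_(x in D `\` D') g x + \int[m]_(x in D') g x.
  by move=> im; rewrite {1}DE Rintegral_setU// -DE.
rewrite !splitI// nuE//=.
have Dfin (m : {finite_measure set T -> \bar R}) : fine (m D) = fine (m (D `\` D')) + fine (m D').
  rewrite {1}DE measureU//; last exact/disj_set2P.
  by rewrite fineD// fin_num_measure.
(* The real part of nu vanishes on D \ D', so a and b coincide there and the bound on g matters only
   on D'. *)
have eqI : \int[a]_(x in D `\` D') g x = \int[b]_(x in D `\` D') g x.
  rewrite /Rintegral; congr fine; apply: eq_measure_integral => B mB BD.
  have := nu0 _ mB BD; rewrite nuE//= => /eqP; rewrite subr_eq0 => /eqP h.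
  by rewrite -[LHS]fineK ?fin_num_measure// h fineK ?fin_num_measure.
have eqD : fine (a (D `\` D')) = fine (b (D `\` D')).
  by have := nu0 _ mDD' (@subset_refl _ _); rewrite nuE//= => /eqP; rewrite subr_eq0 => /eqP.
have gcE (m : {finite_measure set T -> \bar R}) : m.-integrable D' (EFin \o g) ->
  \int[m]_(x in D') (g x - c) = \int[m]_(x in D') g x - c * fine (m D').
  move=> im; rewrite RintegralB ?Rintegral_cst//.
  by apply/finite_measure_integrable_cst.
have icst (m : {finite_measure set T -> \bar R}) : m.-integrable D' (EFin \o g) ->
  m.-integrable D' (fun x => (g x - c)%:E).
  move=> im; rewrite (_ : (fun _ => _) = ((EFin \o g) \- cst c%:E)%E)//.
  by apply: integrableB => //; exact: finite_measure_integrable_cst.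
have : \int[b]_(x in D') (g x - c) <= \int[a]_(x in D') (g x - c).
  rewrite /Rintegral fine_le//; [exact: integrable_fin_num (icst _ _)|
    exact: integrable_fin_num (icst _ _)|].
  apply: le_measure_integral_subset => [B mB BD|x D'x]; last by rewrite lee_fin subr_ge0 cg.
  rewrite -[X in (X <= _)%E]fineK ?fin_num_measure// -[X in (_ <= X)%E]fineK ?fin_num_measure//.
  by rewrite lee_fin -subr_ge0; have := nu_ge0 _ mB (subset_trans BD D'D); rewrite nuE.
rewrite !gcE// eqI !Dfin eqD; lra.
Qed.

Lemma has_cintegralN nu D g z : measurable D ->
  has_cintegral nu D g z -> has_cintegral nu D (fun x => - g x) (- z).
Proof.
move=> mD [a [b [c [d [nuE [ia ib] [ic id] ->]]]]].
have NI (m : {finite_measure set T -> \bar R}) : m.-integrable D (EFin \o g) ->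
    m.-integrable D (EFin \o (fun x => - g x)).
  by move=> im; rewrite (_ : EFin \o _ = -%E \o (EFin \o g))//; exact: integrableN.
exists a, b, c, d; split => //; [by split; exact: NI|by split; exact: NI|].
have NE (m : {finite_measure set T -> \bar R}) : m.-integrable D (EFin \o g) ->
  \int[m]_(x in D) (- g x) = - \int[m]_(x in D) g x.
  by move=> im; under eq_Rintegral do rewrite -mulN1r; rewrite RintegralZl// mulN1r.
rewrite !NE//; apply/eqP; rewrite eq_complex /=; apply/andP; split; apply/eqP; ring.
Qed.

Lemma has_cintegral_le nu D D' g c z : measurable D -> measurable D' ->
  D' `<=` D ->
  (forall B, measurable B -> B `<=` D -> 0 <= complex.Re (nu B)) ->
  (forall B, measurable B -> B `<=` D `\` D' -> complex.Re (nu B) = 0) ->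
  (forall x, D' x -> g x <= c) ->
  has_cintegral nu D g z -> complex.Re z <= c * complex.Re (nu D).
Proof.
move=> mD mD' D'D nu_ge0 nu0 gc /(has_cintegralN mD) zN.
have Ncg x : D' x -> - c <= - g x by move=> D'x; rewrite lerN2 gc.
have := has_cintegral_ge mD mD' D'D nu_ge0 nu0 Ncg zN.
by rewrite raddfN/= mulNr lerN2.
Qed.

End has_cintegral_theory.

(** * The Hilbert space L^2 *)

Lemma sqr_normc (R : realType) (z : R[i]) :
  Normc.normc z ^+ 2 = complex.Re z ^+ 2 + complex.Im z ^+ 2.
Proof. by case: z => a b; rewrite /= sqr_sqrtr// addr_ge0// sqr_ge0. Qed.

Section L2_theory.
Context {R : realType} {n : nat}.
Local Notation T := 'rV[R]_n.
Implicit Types (f g : T -> R) (u v w : T -> R[i]) (a : R[i]).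

Lemma integrable_ext (h k : T -> \bar R) : h =1 k ->
  (leb n).-integrable setT h -> (leb n).-integrable setT k.
Proof. by move=> /funext ->. Qed.

(** The real counterpart of [L2]: through [L2P], closure properties of L^2 reduce to real and
    imaginary parts. *)
Definition sqint f := measurable_fun setT f /\
  (leb n).-integrable setT (fun x => (f x ^+ 2)%:E).

(** Domination: |f g| <= f^2 + g^2. *)
Lemma sqint_integrableM f g : sqint f -> sqint g ->
  (leb n).-integrable setT (EFin \o (fun x => f x * g x)).
Proof.
move=> [mf f2] [mg g2]; apply: le_integrable (integrableD _ f2 g2) => //.
  by apply/measurable_EFinP; exact: measurable_funM.
move=> x _ /=; rewrite lee_fin [leRHS]ger0_norm ?addr_ge0 ?sqr_ge0//.
by rewrite ler_norml; apply/andP; split; nra.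
Qed.

Lemma sqintD f g : sqint f -> sqint g -> sqint (fun x => f x + g x).
Proof.
move=> sf sg; have [mf f2] := sf; have [mg g2] := sg.
split; first exact: measurable_funD.
have fg := sqint_integrableM sf sg.
have fg2 := integrableZl measurableT 2 fg.
apply: integrable_ext (integrableD measurableT (integrableD measurableT f2 g2) fg2) => x /=.
by rewrite -EFinM -!EFinD; congr EFin; ring.
Qed.

Lemma sqintZ (k : R) f : sqint f -> sqint (fun x => k * f x).
Proof.
move=> [mf f2]; split; first exact: measurable_funM.
apply: integrable_ext (integrableZl measurableT (k ^+ 2) f2) => x /=.
by rewrite -EFinM exprMn.
Qed.

Lemma sqintN f : sqint f -> sqint (fun x => - f x).
Proof. by move=> /(sqintZ (-1)); under eq_fun do rewrite mulN1r. Qed.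

Lemma L2P u : L2 u <->
  sqint (fun x => complex.Re (u x)) /\ sqint (fun x => complex.Im (u x)).
Proof.
have nE : (fun x => (Normc.normc (u x) ^+ 2)%:E) =
    (fun x => (complex.Re (u x) ^+ 2)%:E + (complex.Im (u x) ^+ 2)%:E)%E.
  by apply/funext => x; rewrite sqr_normc EFinD.
split=> [[[mr mi]]|[[mr r2] [mi i2]]]; last first.
  split=> //=; rewrite nE.
  have /integrableP[_] := integrableD measurableT r2 i2; apply: le_lt_trans.
  by apply: ge0_le_integral => //=; [move=> x _; rewrite adde_ge0// lee_fin sqr_ge0|
    apply/measurable_EFinP; apply: measurable_funD; exact: measurable_funX|
    apply/measurable_EFinP/measurableT_comp => //; apply: measurable_funD; exact: measurable_funX|
    move=> x _; rewrite lee_fin ler_norm].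
rewrite nE => fin_u.
have mr2 : measurable_fun setT (fun x => complex.Re (u x) ^+ 2) by exact: measurable_funX.
have mi2 : measurable_fun setT (fun x => complex.Im (u x) ^+ 2) by exact: measurable_funX.
have iu : (leb n).-integrable setT
    (fun x => (complex.Re (u x) ^+ 2)%:E + (complex.Im (u x) ^+ 2)%:E)%E.
  apply/integrableP; split; first by apply/measurable_EFinP; exact: measurable_funD.
  by under eq_integral do rewrite gee0_abs ?adde_ge0 ?lee_fin ?sqr_ge0//.
split; split => //; apply: le_integrable iu => //; try exact/measurable_EFinP;
  by move=> x _ /=; rewrite lee_fin !ger0_norm ?addr_ge0 ?sqr_ge0// ?lerDl ?lerDr sqr_ge0.
Qed.

Lemma L2_cmeasurable u : L2 u -> cmeasurable u. Proof. by case. Qed.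

Lemma L2_le u v : cmeasurable u -> L2 v ->
  (forall x, Normc.normc (u x) <= Normc.normc (v x)) -> L2 u.
Proof.
move=> [mr mi] [[mr' mi'] v2] uv; split => //=; apply: le_lt_trans v2.
have m2 w : cmeasurable w -> measurable_fun setT (fun x => (Normc.normc (w x) ^+ 2)%:E).
  move=> [? ?]; apply/measurable_EFinP; under eq_fun do rewrite sqr_normc.
  by apply: measurable_funD; exact: measurable_funX.
apply: ge0_le_integral => //; [|exact: m2|exact: m2|].
- by move=> x _; rewrite lee_fin sqr_ge0.
- move=> x _; rewrite lee_fin ler_pXn2r ?nnegrE//.
  + by case: (u x) => ? ?; rewrite sqrtr_ge0.
  + by case: (v x) => ? ?; rewrite sqrtr_ge0.
Qed.

Lemma cReM (z z' : R[i]) : complex.Re (z * z') =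
  complex.Re z * complex.Re z' - complex.Im z * complex.Im z'.
Proof. by case: z => ? ?; case: z'. Qed.

Lemma cImM (z z' : R[i]) : complex.Im (z * z') =
  complex.Re z * complex.Im z' + complex.Im z * complex.Re z'.
Proof. by case: z => ? ?; case: z'. Qed.

Lemma cReD (z z' : R[i]) : complex.Re (z + z') = complex.Re z + complex.Re z'.
Proof. by case: z => ? ?; case: z'. Qed.

Lemma cImD (z z' : R[i]) : complex.Im (z + z') = complex.Im z + complex.Im z'.
Proof. by case: z => ? ?; case: z'. Qed.

Lemma cReJ (z : R[i]) : complex.Re z^* = complex.Re z. Proof. by case: z. Qed.
Lemma cImJ (z : R[i]) : complex.Im z^* = - complex.Im z. Proof. by case: z. Qed.

Lemma complexP (z z' : R[i]) : complex.Re z = complex.Re z' ->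
  complex.Im z = complex.Im z' -> z = z'.
Proof. by case: z => ? ?; case: z' => ? ? /= -> ->. Qed.

Lemma L2_lin a u v : L2 u -> L2 v -> L2 (fun x => a * u x + v x).
Proof.
move=> /L2P[ru iu] /L2P[rv iv]; apply/L2P; split.
- under eq_fun do rewrite cReD cReM; apply: sqintD => //; apply: sqintD; first exact: sqintZ.
  by apply: sqintN; exact: sqintZ.
- under eq_fun do rewrite cImD cImM; apply: sqintD => //.
  by apply: sqintD; exact: sqintZ.
Qed.

Lemma L2_0 : L2 (fun _ : T => 0 : R[i]).
Proof.
apply/L2P; split; split => //=; rewrite expr0n /=; exact: integrable0.
Qed.

Lemma L2D u v : L2 u -> L2 v -> L2 (fun x => u x + v x).
Proof. by move=> /(L2_lin 1)/[apply]; under eq_fun do rewrite mul1r. Qed.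

Lemma L2Z a u : L2 u -> L2 (fun x => a * u x).
Proof. by move=> /(L2_lin a)/(_ L2_0); under eq_fun do rewrite addr0. Qed.

Lemma L2B u v : L2 u -> L2 v -> L2 (fun x => u x - v x).
Proof.
move=> Lu Lv; rewrite (_ : (fun _ => _) = (fun x => -1 * v x + u x)).
  exact: L2_lin.
by apply/funext => x; rewrite mulN1r addrC.
Qed.

Definition cintegrable u :=
  (leb n).-integrable setT (EFin \o (fun x => complex.Re (u x))) /\
  (leb n).-integrable setT (EFin \o (fun x => complex.Im (u x))).

Lemma cintegralD u v : cintegrable u -> cintegrable v ->
  cintegral (fun x => u x + v x) = cintegral u + cintegral v.
Proof.
move=> [ru iu] [rv iv]; apply: complexP; rewrite ?cReD ?cImD /=.
- by under eq_Rintegral do rewrite cReD; rewrite RintegralD.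
- by under eq_Rintegral do rewrite cImD; rewrite RintegralD.
Qed.

Let integrableZ (k : R) f : (leb n).-integrable setT (EFin \o f) ->
  (leb n).-integrable setT (EFin \o (fun x => k * f x)).
Proof. by move=> /(integrableZl measurableT k). Qed.

Let integrableMinus f : (leb n).-integrable setT (EFin \o f) ->
  (leb n).-integrable setT (EFin \o (fun x => - f x)).
Proof. by move=> /(integrableZ (-1)); under eq_fun do rewrite mulN1r. Qed.

Let integrablePlus f g : (leb n).-integrable setT (EFin \o f) ->
  (leb n).-integrable setT (EFin \o g) ->
  (leb n).-integrable setT (EFin \o (fun x => f x + g x)).
Proof. by move=> fi /(integrableD measurableT fi). Qed.

Lemma cintegrableZ a u : cintegrable u -> cintegrable (fun x => a * u x).
Proof.
move=> [ru iu]; split.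
- under eq_fun do rewrite cReM; apply: integrablePlus; first exact: integrableZ.
  by apply: integrableMinus; exact: integrableZ.
- by under eq_fun do rewrite cImM; apply: integrablePlus; exact: integrableZ.
Qed.

Lemma cintegralZ a u : cintegrable u ->
  cintegral (fun x => a * u x) = a * cintegral u.
Proof.
move=> [ru iu]; apply: complexP; rewrite ?cReM ?cImM /=.
- under eq_Rintegral do rewrite cReM; rewrite RintegralB ?RintegralZl//; exact: integrableZ.
- under eq_Rintegral do rewrite cImM; rewrite RintegralD ?RintegralZl//; exact: integrableZ.
Qed.

Lemma cintegralJ u : cintegrable u ->
  cintegral (fun x => (u x)^*) = (cintegral u)^*.
Proof.
move=> [ru iu]; apply: complexP; rewrite ?cReJ ?cImJ /=.
- by under eq_Rintegral do rewrite cReJ.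
- by under eq_Rintegral do rewrite cImJ -mulN1r; rewrite RintegralZl// mulN1r.
Qed.

Lemma cmeasurableM u v : cmeasurable u -> cmeasurable v -> cmeasurable (fun x => u x * v x).
Proof.
move=> [? ?] [? ?]; split.
- by under eq_fun do rewrite cReM; apply: measurable_funB; exact: measurable_funM.
- by under eq_fun do rewrite cImM; apply: measurable_funD; exact: measurable_funM.
Qed.

Lemma cmeasurableJ u : cmeasurable u -> cmeasurable (fun x => (u x)^*).
Proof.
move=> [? ?]; split; first by under eq_fun do rewrite cReJ.
by under eq_fun do rewrite cImJ; exact: measurableT_comp.
Qed.

Lemma cmeasurable_real f : measurable_fun setT f -> cmeasurable (fun x => (f x)%:C).
Proof. by move=> mf; split. Qed.

Lemma ae_equal_refl u : ae_equal u u. Proof. exact: nearW. Qed.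

Lemma ae_equal_sym u v : ae_equal u v -> ae_equal v u.
Proof. by apply: filterS => x ->. Qed.

Lemma ae_equal_trans v u w : ae_equal u v -> ae_equal v w -> ae_equal u w.
Proof. by apply: filterS2 => x -> ->. Qed.

Lemma cintegral_ae u v : cmeasurable u -> cmeasurable v ->
  ae_equal u v -> cintegral u = cintegral v.
Proof.
move=> [mu1 mu2] [mv1 mv2] uv; apply: complexP; rewrite /= /Rintegral; congr fine;
  apply: ae_eq_integral => //; try exact/measurable_EFinP;
  by apply: filterS uv => x -> _.
Qed.

Lemma cintegrable_inner u v : L2 u -> L2 v -> cintegrable (fun x => u x * (v x)^*).
Proof.
move=> /L2P[ru iu] /L2P[rv iv]; split.
- under eq_fun do rewrite cReM cReJ cImJ mulrN opprK.
  by apply: integrablePlus; exact: sqint_integrableM.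
- under eq_fun do rewrite cImM cReJ cImJ mulrN addrC.
  by apply: integrablePlus; [|apply: integrableMinus]; exact: sqint_integrableM.
Qed.

Lemma inner_ae u u' v v' : cmeasurable u -> cmeasurable u' ->
  cmeasurable v -> cmeasurable v' ->
  ae_equal u u' -> ae_equal v v' -> inner u v = inner u' v'.
Proof.
move=> mu mu' mv mv' uu' vv'; apply: cintegral_ae.
- by apply: cmeasurableM => //; exact: cmeasurableJ.
- by apply: cmeasurableM => //; exact: cmeasurableJ.
- by apply: filterS2 uu' vv' => x -> ->.
Qed.

Lemma inner_linl a u v w : L2 u -> L2 v -> L2 w ->
  inner (fun x => a * u x + v x) w = a * inner u w + inner v w.
Proof.
move=> Lu Lv Lw; rewrite /inner.
under [in LHS](_ : (fun _ => _) = fun x => a * (u x * (w x)^*) + v x * (w x)^*).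
  by apply/funext => x; rewrite mulrDl mulrA.
rewrite cintegralD ?cintegralZ//; try exact: cintegrable_inner.
by apply: cintegrableZ; exact: cintegrable_inner.
Qed.

Lemma innerJ u v : L2 u -> L2 v -> inner v u = (inner u v)^*.
Proof.
move=> Lu Lv; rewrite /inner -cintegralJ; last exact: cintegrable_inner.
by congr cintegral; apply/funext => x; rewrite rmorphM/= conjcK mulrC.
Qed.

Lemma inner_linr a u v w : L2 u -> L2 v -> L2 w ->
  inner w (fun x => a * u x + v x) = a^* * inner w u + inner w v.
Proof.
move=> Lu Lv Lw; rewrite innerJ//; last exact: L2_lin.
by rewrite inner_linl// rmorphD rmorphM /= (innerJ Lu Lw) (innerJ Lv Lw).
Qed.

Lemma innerBl u v w : L2 u -> L2 v -> L2 w ->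
  inner (fun x => u x - v x) w = inner u w - inner v w.
Proof.
move=> Lu Lv Lw; rewrite (_ : (fun _ => _) = (fun x => -1 * v x + u x)).
  by rewrite inner_linl// mulN1r addrC.
by apply/funext => x; rewrite mulN1r addrC.
Qed.

Lemma inner0l w : L2 w -> inner (fun=> 0) w = 0.
Proof.
move=> Lw; rewrite -[RHS](subrr (inner (fun=> 0) w)) -(innerBl L2_0 L2_0 Lw).
by congr inner; apply/funext => x; rewrite subrr.
Qed.

Lemma inner0r w : L2 w -> inner w (fun=> 0) = 0.
Proof. by move=> Lw; rewrite innerJ ?inner0l ?conjc0//; exact: L2_0. Qed.

(** [sqnorm] with values in R; the two agree on L^2 by [sqnormE]. *)
Definition nrm2 u : R := complex.Re (inner u u).

Lemma inner_nrm2 u : L2 u -> inner u u = (nrm2 u)%:C.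
Proof.
move=> Lu; apply: complexP => //=; rewrite /Rintegral integral0_eq//= => x _.
by rewrite cImM cReJ cImJ; congr EFin; ring.
Qed.

Lemma sqnormE u : L2 u -> sqnorm u = (nrm2 u)%:E.
Proof.
move=> Lu; have [ci _] := cintegrable_inner Lu Lu.
rewrite /nrm2 /= /Rintegral fineK; last exact: integrable_fin_num.
apply: eq_integral => x _; rewrite sqr_normc cReM cReJ cImJ; congr EFin; ring.
Qed.

Lemma nrm2_ge0 u : L2 u -> 0 <= nrm2 u.
Proof.
by move=> Lu; rewrite -lee_fin -sqnormE//; apply: integral_ge0 => x _; rewrite lee_fin sqr_ge0.
Qed.

Lemma nrm2_ae u v : cmeasurable u -> cmeasurable v -> ae_equal u v -> nrm2 u = nrm2 v.
Proof. by move=> mu mv uv; rewrite /nrm2 (inner_ae mu mv mu mv uv uv). Qed.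

Lemma cmeasurable_normc2 u : cmeasurable u ->
  measurable_fun setT (fun x => Normc.normc (u x) ^+ 2).
Proof.
move=> [mr mi]; under eq_fun do rewrite sqr_normc.
by apply: measurable_funD; exact: measurable_funX.
Qed.

Lemma sqr_normc_eq0 (z : R[i]) : Normc.normc z ^+ 2 = 0 -> z = 0.
Proof. by move=> /eqP; rewrite sqrf_eq0 => /eqP /ComplexField.Normc.eq0_normc. Qed.

Lemma sqnorm0_ae u : cmeasurable u -> sqnorm u = 0%E -> ae_equal u (fun=> 0).
Proof.
move=> mu u0.
have mn : measurable_fun setT (fun x => (Normc.normc (u x) ^+ 2)%:E).
  by apply/measurable_EFinP; exact: cmeasurable_normc2.
have : ae_eq (leb n) setT (fun x => (Normc.normc (u x) ^+ 2)%:E) (cst 0%E).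
  apply/ae_eq_integral_abs => //.
  by rewrite -[RHS]u0; apply: eq_integral => x _; rewrite gee0_abs// lee_fin sqr_ge0.
by apply: filterS => x /(_ I) [] /sqr_normc_eq0.
Qed.

Lemma nrm2_eq0 u : L2 u -> nrm2 u = 0 -> ae_equal u (fun=> 0).
Proof. by move=> Lu u0; apply: sqnorm0_ae; [case: Lu|rewrite sqnormE// u0]. Qed.

Lemma ae_equal_sub0 u v : ae_equal (fun x => u x - v x) (fun=> 0) -> ae_equal u v.
Proof. by apply: filterS => x /eqP; rewrite subr_eq0 => /eqP. Qed.

(** Testing against w = u - v gives |u - v|^2 = 0. *)
Lemma inner_ext u v : L2 u -> L2 v ->
  (forall w, L2 w -> inner u w = inner v w) -> ae_equal u v.
Proof.
move=> Lu Lv h; apply: ae_equal_sub0; have Luv := L2B Lu Lv.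
apply: nrm2_eq0 => //; rewrite /nrm2 innerBl// h// subrr//.
Qed.

End L2_theory.
#[global] Hint Resolve ae_equal_refl : core.

(** Only the coefficients of the form appear, because the lemma serves both the L^2 inner product
    and the positive form <rho u, G_A w>. Hermitian symmetry comes out of the hypothesis: real
    values at t = 1 and t = i force z' to be the conjugate of z. *)
Lemma psd_form_cauchy_schwarz (R : realType) (A B : R) (z z' : R[i]) :
  0 <= A ->
  (forall t : R[i], exists2 r : R, 0 <= r &
     t * t^* * A%:C + t * z + t^* * z' + B%:C = r%:C) ->
  Normc.normc z ^+ 2 <= A * B.
Proof.
case: z => x y; case: z' => x' y' A0 h; rewrite sqr_normc/=.
have [r1 _ [_ h1]] := h 1; have [ri _ [_ hi]] := h 'i.
move: h1 hi => /=; rewrite !(mul0r, mulr0, mul1r, mulr1, add0r, addr0, oppr0).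
rewrite !(subr0, mulN1r, sub0r) => h1 hi.
have x'E : x' = x by move/eqP: hi; rewrite subr_eq0 => /eqP.
have y'E : y' = - y by apply/eqP; rewrite -addr_eq0 addrC h1.
have B0 : 0 <= B.
  by have [r r0 [+ _]] := h 0 => /=; rewrite !(mul0r, mulr0, add0r, subr0, oppr0) => BE; rewrite BE.
pose N := x ^+ 2 + y ^+ 2.
(* Here t is -s times the conjugate of z, so both cross terms equal -s |z|^2. *)
have key (s : R) : 0 <= s ^+ 2 * N * A - 2 * s * N + B.
  have [r r0 [+ _]] := h (- (s * x) +i* (s * y)) => /= E.
  suff <- : r = s ^+ 2 * N * A - 2 * s * N + B by [].
  rewrite -E /N x'E y'E; ring.
have N0 : 0 <= N by rewrite addr_ge0 ?sqr_ge0.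
rewrite -/N; move: A0; rewrite le_eqVlt => /predU1P[A0|A0].
  rewrite -A0 mul0r; rewrite leNgt; apply/negP => Np.
  (* With A = 0 the form reduces to B - 2 s N, and this s makes it -B - 2 < 0. *)
  have := key ((B + 1) / N); rewrite -A0 mulr0 sub0r.
  have -> : 2 * ((B + 1) / N) * N = 2 * (B + 1) by field; lra.
  lra.
(* The quadratic in s is smallest at s = 1/A. *)
have := key A^-1.
have -> : A^-1 ^+ 2 * N * A - 2 * A^-1 * N + B = (A * B - N) / A by field; lra.
by rewrite pmulr_lge0 ?invr_gt0// subr_ge0.
Qed.

Lemma inner_cauchy_schwarz (R : realType) n (u v : 'rV[R]_n -> R[i]) :
  L2 u -> L2 v -> Normc.normc (inner u v) ^+ 2 <= nrm2 u * nrm2 v.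
Proof.
move=> Lu Lv; apply: (psd_form_cauchy_schwarz (z' := inner v u)); first exact: nrm2_ge0.
move=> t; exists (nrm2 (fun x => t * u x + v x)).
  by apply: nrm2_ge0; exact: L2_lin.
have Lw := L2_lin t Lu Lv.
rewrite -(inner_nrm2 Lw) (inner_linl t Lu Lv Lw) (inner_linr t Lu Lv Lu) (inner_linr t Lu Lv Lv).
rewrite -(inner_nrm2 Lu) -(inner_nrm2 Lv); ring.
Qed.

(** * Multiplication by real functions *)

Section rmul.
Context {R : realType} {n : nat}.
Local Notation T := 'rV[R]_n.
Implicit Types (f g : T -> R) (u v w : T -> R[i]).

Definition rmul f u := fun x => (f x)%:C * u x.

Lemma normc_ge0 (z : R[i]) : 0 <= Normc.normc z.
Proof. by case: z => ? ?; rewrite sqrtr_ge0. Qed.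

Lemma normc_real (x : R) : Normc.normc x%:C = `|x|.
Proof. by rewrite /= expr0n/= addr0 sqrtr_sqr. Qed.

Lemma cReC (x : R) : complex.Re x%:C = x. Proof. by []. Qed.

Lemma normc_rmul f u x : Normc.normc (rmul f u x) = `|f x| * Normc.normc (u x).
Proof. by rewrite Normc.normcM normc_real. Qed.

Lemma cmeasurable_rmul f u : measurable_fun setT f -> cmeasurable u ->
  cmeasurable (rmul f u).
Proof. by move=> mf mu; apply: cmeasurableM => //; exact: cmeasurable_real. Qed.

(** The bound is asked only where u does not vanish, so that powers of an unbounded rho, or of its
    inverse, can act on functions supported where rho is bounded, or bounded away from 0. *)
Lemma L2_rmul (K : R) f u : measurable_fun setT f -> L2 u ->
  (forall x, u x != 0 -> `|f x| <= K) -> L2 (rmul f u).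
Proof.
move=> mf Lu fK; apply: (@L2_le _ _ _ (fun x => K%:C * u x)).
- by apply: cmeasurable_rmul => //; case: Lu.
- exact: L2Z.
move=> x; rewrite normc_rmul Normc.normcM normc_real.
have [->|ux0] := eqVneq (u x) 0; first by rewrite Normc.normc0 !mulr0.
by rewrite ler_wpM2r ?normc_ge0// (le_trans (fK _ ux0))// ler_norm.
Qed.

Lemma nrm2_le u v : L2 u -> L2 v ->
  (forall x, Normc.normc (u x) <= Normc.normc (v x)) -> nrm2 u <= nrm2 v.
Proof.
move=> Lu Lv uv; rewrite -lee_fin -!sqnormE//; apply: ge0_le_integral => //.
- by move=> x _; rewrite lee_fin sqr_ge0.
- by apply/measurable_EFinP; apply: cmeasurable_normc2; case: Lu.
- by apply/measurable_EFinP; apply: cmeasurable_normc2; case: Lv.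
- by move=> x _; rewrite lee_fin ler_pXn2r ?nnegrE ?normc_ge0.
Qed.

Lemma nrm2_Z (K : R) u : L2 u -> nrm2 (fun x => K%:C * u x) = K ^+ 2 * nrm2 u.
Proof.
move=> Lu; have LKu := L2Z K%:C Lu.
have E := inner_linl K%:C Lu L2_0 LKu.
have E' := inner_linr K%:C Lu L2_0 Lu.
rewrite /nrm2; transitivity (complex.Re (inner (fun x => K%:C * u x + 0) (fun x => K%:C * u x))).
  by congr (complex.Re (inner _ _)); apply/funext => x; rewrite addr0.
rewrite E inner0l// addr0.
have -> : inner u (fun x => K%:C * u x) = inner u (fun x => K%:C * u x + 0).
  by congr (inner _ _); apply/funext => x; rewrite addr0.
rewrite E' inner0r// addr0 inner_nrm2// /=; ring.
Qed.

Lemma nrm2_rmul_le (K : R) f u : measurable_fun setT f -> L2 u ->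
  (forall x, u x != 0 -> `|f x| <= K) -> nrm2 (rmul f u) <= K ^+ 2 * nrm2 u.
Proof.
move=> mf Lu fK; rewrite -nrm2_Z//; apply: nrm2_le.
- exact: L2_rmul fK.
- exact: L2Z.
move=> x; rewrite normc_rmul Normc.normcM normc_real.
have [->|ux0] := eqVneq (u x) 0; first by rewrite Normc.normc0 !mulr0.
by rewrite ler_wpM2r ?normc_ge0// (le_trans (fK _ ux0))// ler_norm.
Qed.

Lemma inner_rmul f u v : inner (rmul f u) v = inner u (rmul f v).
Proof.
rewrite /inner; congr cintegral; apply/funext => x.
by rewrite /rmul; apply: complexP; rewrite !(cReM, cImM, cReJ, cImJ)/=; ring.
Qed.

Lemma ae_equal_rmul f u v : ae_equal u v -> ae_equal (rmul f u) (rmul f v).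
Proof. by apply: filterS => x; rewrite /rmul => ->. Qed.

Lemma sqnorm_ae u v : cmeasurable u -> cmeasurable v -> ae_equal u v ->
  sqnorm u = sqnorm v.
Proof.
move=> mu mv uv; apply: ae_eq_integral => //.
- by apply/measurable_EFinP; exact: cmeasurable_normc2.
- by apply/measurable_EFinP; exact: cmeasurable_normc2.
- by apply: filterS uv => x ->.
Qed.

End rmul.

Lemma geometric_le0 (R : realType) (q x M : R) :
  0 <= q -> q < 1 -> (forall k, x <= q ^+ k * M) -> x <= 0.
Proof.
move=> q0 q1 h.
have cq : geometric M q k @[k --> \oo] --> 0 by apply: cvg_geometric; rewrite ger0_norm.
rewrite -(cvg_lim _ cq)//; apply: limr_ge; first by apply/cvg_ex; exists 0.
by apply: nearW => k; rewrite /geometric/= mulrC.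
Qed.

(** * Spectral measures *)

Section spectral_measure_theory.
Context {R : realType} {n : nat}.
Local Notation T := 'rV[R]_n.
Local Notation set := (set (measurableTypeR R)).
Implicit Types (f g : T -> R) (u v w : T -> R[i]) (A B : set).

Variable E : classical_sets.set R -> (T -> R[i]) -> T -> R[i].
Hypothesis hE : spectral_measure E.

Lemma measurable_halfline : measurable (halfline : set).
Proof. exact: measurable_itv. Qed.

(** The sets on which [spectral_measure] constrains E. *)
Definition spec_set B := measurable B /\ B `<=` halfline.

Lemma spec_setIl A B : spec_set A -> measurable B -> spec_set (A `&` B).
Proof.
by move=> [mA AH] mB; split; [exact: measurableI|move=> x [/AH]].
Qed.

Lemma spec_set_halfline B : measurable B -> spec_set (B `&` halfline).
Proof.
move=> mB; split; last by move=> x [].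
by apply: measurableI => //; exact: measurable_halfline.
Qed.

Lemma spec_set_setT : spec_set halfline.
Proof. by split=> //; exact: measurable_halfline. Qed.

Lemma spec_set0 : spec_set set0.
Proof. by split; [exact: measurable0|exact: sub0set]. Qed.

Lemma spec_L2 B u : spec_set B -> L2 u -> L2 (E B u).
Proof. by move=> [mB BH]; exact: (lin_L2 (spec_linear hE mB BH)). Qed.

Lemma spec_ae B u v : spec_set B -> L2 u -> L2 v -> ae_equal u v ->
  ae_equal (E B u) (E B v).
Proof. by move=> [mB BH]; exact: (lin_ae (spec_linear hE mB BH)). Qed.

Lemma spec_lin B a u v : spec_set B -> L2 u -> L2 v ->
  ae_equal (E B (fun x => a * u x + v x)) (fun x => a * E B u x + E B v x).
Proof. by move=> [mB BH]; exact: (lin_lin (spec_linear hE mB BH)). Qed.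

Lemma spec_sym B u v : spec_set B -> L2 u -> L2 v ->
  inner (E B u) v = inner u (E B v).
Proof. by move=> [mB BH]; exact: spec_selfadjoint. Qed.

Lemma inner_ae_L2 u u' v v' : L2 u -> L2 u' -> L2 v -> L2 v' ->
  ae_equal u u' -> ae_equal v v' -> inner u v = inner u' v'.
Proof.
by move=> /L2_cmeasurable ? /L2_cmeasurable ? /L2_cmeasurable ? /L2_cmeasurable ?;
  exact: inner_ae.
Qed.

Lemma inner_spec2 A B u v : spec_set A -> spec_set B -> L2 u -> L2 v ->
  inner (E A u) (E B v) = inner (E (A `&` B) u) v.
Proof.
move=> sA sB Lu Lv; have sAB := spec_setIl sA sB.1.
have LAu := spec_L2 sA Lu.
rewrite -spec_sym//; apply: inner_ae_L2 => //; try exact: spec_L2.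
apply: ae_equal_sym; rewrite setIC.
exact: (spec_setI hE sB.1 sB.2 sA.1 sA.2 Lu).
Qed.

Lemma nrm2_spec B u : spec_set B -> L2 u -> inner (E B u) u = (nrm2 (E B u))%:C.
Proof.
move=> sB Lu; rewrite -inner_nrm2; last exact: spec_L2.
by rewrite inner_spec2// setIid.
Qed.

(** Since |E_B u|^2 = <E_B u, u>, Cauchy-Schwarz gives |E_B u|^4 <= |E_B u|^2 |u|^2. *)
Lemma nrm2_spec_le B u : spec_set B -> L2 u -> nrm2 (E B u) <= nrm2 u.
Proof.
move=> sB Lu; have LBu := spec_L2 sB Lu.
have := inner_cauchy_schwarz LBu Lu; rewrite nrm2_spec// normc_real real_normK ?num_real//.
have := nrm2_ge0 LBu; have := nrm2_ge0 Lu => u0 v0 h.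
by rewrite leNgt; apply/negP => uv; nra.
Qed.

(** The threshold is chosen for [bigcup2], whose terms are empty from index 2 on. *)
Lemma cvg0_near_cst_eq0 (s : (\bar R)^nat) (c : \bar R) : s @ \oo --> 0%E ->
  (forall k, (1 < k)%N -> s k = c) -> c = 0%E.
Proof.
move=> s0 sc; apply: (cvg_unique _ _ s0) => //.
by apply: cvg_near_cst; exists 2%N => // k /= /sc.
Qed.

Lemma L2_sum (h : nat -> T -> R[i]) N :
  (forall k, L2 (h k)) -> L2 (fun x => \sum_(k < N) h k x).
Proof.
move=> Lh; elim: N => [|N ih].
  rewrite (_ : (fun _ => _) = (fun=> 0)); first exact: L2_0.
  by apply/funext => x; rewrite big_ord0.
rewrite (_ : (fun _ => _) = (fun x => (\sum_(k < N) h k x) + h N x)); first exact: L2D.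
by apply/funext => x; rewrite big_ord_recr.
Qed.

(** Additivity is applied to the constant sequence of empty sets: the remainder after N terms is 1 -
    N times E of the empty set, so for N >= 2 its norm is at least that of the term itself, and it
    tends to 0. *)
Lemma spec_set0_ae u : L2 u -> ae_equal (E set0 u) (fun=> 0).
Proof.
move=> Lu; have L0 := spec_L2 spec_set0 Lu.
apply: nrm2_eq0 => //.
have h := spec_additive hE (fun _ : nat => spec_set0.1) (fun _ => spec_set0.2)
  (@trivIset_set0 _ _ setT) Lu.
rewrite bigcup0// in h.
have hle N : (2 <= N)%N ->
  ((nrm2 (E set0 u))%:E <= sqnorm (fun x => E set0 u x - \sum_(k < N) E set0 u x)%R)%E.
  move=> N2; rewrite sqnormE; last by apply: L2B => //; exact: (@L2_sum (fun _ => E set0 u)).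
  rewrite lee_fin.
  have -> : (fun x => E set0 u x - \sum_(k < N) E set0 u x) =
      (fun x => (1 - N%:R : R)%:C * E set0 u x)%R.
    apply/funext => x; rewrite sumr_const card_ord rmorphB/= rmorph1 mulrBl mul1r.
    by rewrite rmorph_nat mulr_natl.
  rewrite nrm2_Z// ler_peMl ?nrm2_ge0//.
  rewrite -sqrrN opprB -[leLHS](expr1n _ 2) ler_pXn2r ?nnegrE//;
    rewrite ?subr_ge0 ?lerBrDr ?ler1n ?(ltnW N2)//.
  by rewrite -(natrD _ 1 1) ler_nat.
apply/eqP; rewrite eq_le nrm2_ge0// andbT -lee_fin -[leRHS](cvg_lim _ h)//.
apply: lime_ge; first by apply/cvg_ex; exists 0%E.
by exists 2%N => // N /= /hle.
Qed.

(** Every partial sum vanishes almost everywhere, so the remainder is constant, equal to the value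
    on the union, and tends to 0. *)
Lemma spec_bigcup0 (B : nat -> set) u : (forall k, spec_set (B k)) ->
  trivIset setT B -> L2 u -> (forall k, ae_equal (E (B k) u) (fun=> 0)) ->
  ae_equal (E (\bigcup_k B k) u) (fun=> 0).
Proof.
move=> sB tB Lu B0.
have sU : spec_set (\bigcup_k B k).
  by split; [apply: bigcupT_measurable => k; exact: (sB k).1|
    apply: bigcup_sub => k _; exact: (sB k).2].
have LU := spec_L2 sU Lu.
apply: sqnorm0_ae; first by case: LU.
apply: cvg0_near_cst_eq0 (spec_additive hE (fun k => (sB k).1) (fun k => (sB k).2) tB Lu) _ => N _.
apply: sqnorm_ae; [|by case: LU|].
  apply: L2_cmeasurable; apply: L2B => //.
  by apply: (@L2_sum (fun k => E (B k) u)) => k; exact: spec_L2.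
apply: filterS (ae_foralln B0) => x Bx.
by rewrite big1 ?subr0// => k _; exact: Bx.
Qed.

(** Countable additivity along [bigcup2]: the remainder is stationary from N = 2 on, because the
    later terms are values of E at the empty set. *)
Lemma spec_setU2 A B u : spec_set A -> spec_set B -> A `&` B = set0 -> L2 u ->
  ae_equal (E (A `|` B) u) (fun x => E A u x + E B u x).
Proof.
move=> sA sB AB0 Lu.
have sF k : spec_set (bigcup2 A B k).
  by rewrite /bigcup2; case: ifP => // _; case: ifP => // _; exact: spec_set0.
have sU : spec_set (A `|` B).
  by split; [exact: measurableU sA.1 sB.1|rewrite subUset; split; [exact: sA.2|exact: sB.2]].
have LU := spec_L2 sU Lu; have LA := spec_L2 sA Lu; have LB := spec_L2 sB Lu.
have Ld : L2 (fun x => E (A `|` B) u x - (E A u x + E B u x)).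
  by apply: L2B => //; exact: L2D.
apply: ae_equal_sub0; apply: sqnorm0_ae; first by case: Ld.
have tF : trivIset setT (bigcup2 A B) by rewrite -trivIset_bigcup2.
have h := spec_additive hE (fun k => (sF k).1) (fun k => (sF k).2) tF Lu.
rewrite bigcup2E in h.
apply: cvg0_near_cst_eq0 h _ => -[//|[//|N]] _.
apply: sqnorm_ae; [|by case: Ld|].
  apply: L2_cmeasurable; apply: L2B => //.
  by apply: (@L2_sum (fun k => E (bigcup2 A B k) u)) => k; exact: spec_L2.
apply: filterS (spec_set0_ae Lu) => x x0.
by rewrite 2!big_ord_recl /= big1 ?addr0.
Qed.

(* Self-adjointness transfers the orthogonality of the ranges of E_B and of a
   multiplication projection from one side to the other. *)
Lemma spec_rmul0_sym B f : spec_set B -> measurable_fun setT f ->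
  (forall x, `|f x| <= 1) ->
  (forall u, L2 u -> ae_equal (E B (rmul f u)) (fun=> 0)) ->
  forall u, L2 u -> ae_equal (rmul f (E B u)) (fun=> 0).
Proof.
move=> sB mf f1 h u Lu.
have L2f v : L2 v -> L2 (rmul f v) by move=> Lv; apply: (L2_rmul (K := 1)) => // x _.
have LBu := spec_L2 sB Lu.
apply: inner_ext; [exact: L2f|exact: L2_0|] => w Lw.
rewrite inner_rmul spec_sym//; last exact: L2f.
rewrite inner0l// (inner_ae_L2 (u' := u) (v' := fun=> 0)) ?inner0r//.
- by apply: spec_L2 => //; exact: L2f.
- exact: L2_0.
- exact: h.
Qed.

Lemma rmul_spec0_sym B f : spec_set B -> measurable_fun setT f ->
  (forall x, `|f x| <= 1) ->
  (forall u, L2 u -> ae_equal (rmul f (E B u)) (fun=> 0)) ->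
  forall u, L2 u -> ae_equal (E B (rmul f u)) (fun=> 0).
Proof.
move=> sB mf f1 h u Lu.
have L2f v : L2 v -> L2 (rmul f v) by move=> Lv; apply: (L2_rmul (K := 1)) => // x _.
apply: inner_ext; [by apply: spec_L2 => //; exact: L2f|exact: L2_0|] => w Lw.
have LBw := spec_L2 sB Lw.
rewrite spec_sym//; last exact: L2f.
rewrite inner_rmul inner0l// (inner_ae_L2 (u' := u) (v' := fun=> 0)) ?inner0r//.
- exact: L2f.
- exact: L2_0.
- exact: h.
Qed.

End spectral_measure_theory.

(** * Uniqueness of the spectral measure of a multiplication operator *)

Section spectral_uniqueness.
Context {R : realType} {n : nat}.
Local Notation T := 'rV[R]_n.
Local Notation set := (set (measurableTypeR R)).
Implicit Types (f : T -> R) (g h u v w : T -> R[i]) (A B : set).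

Variable G : classical_sets.set R -> (T -> R[i]) -> T -> R[i].
Hypothesis hG : spectral_measure G.
Variable rho : T -> R.
Hypothesis mrho : measurable_fun setT rho.
Hypothesis rho_ge0 : forall x, 0 <= rho x.
(** In weak form: multiplication by rho on its maximal domain is a restriction of the operator
    resolved by G. *)
Hypothesis Grho : forall g h, L2 g -> L2 (rmul rho g) -> L2 h ->
  has_cintegral (spec_form G g h) halfline id (inner (rmul rho g) h).

Let G_L2 B u : spec_set B -> L2 u -> L2 (G B u). Proof. exact: spec_L2. Qed.

Let nrm20 : nrm2 (fun _ : T => 0 : R[i]) = 0 :> R.
Proof. by rewrite /nrm2 inner0l//; exact: (@L2_0 R n). Qed.

Let nrm2_spec0 B u : B = set0 -> L2 u -> nrm2 (G B u) = 0.
Proof.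
move=> -> Lu; have L0 := G_L2 spec_set0 Lu.
rewrite -nrm20; apply: nrm2_ae; [by case: L0|by case: (@L2_0 R n)|].
exact: spec_set0_ae.
Qed.

Let spec_formE A u B : spec_set A -> measurable B -> L2 u ->
  spec_form G u (G A u) B = (nrm2 (G (B `&` halfline `&` A) u))%:C.
Proof.
move=> sA mB Lu; have sB := spec_set_halfline mB.
by rewrite /spec_form inner_spec2// nrm2_spec//; exact: spec_setIl sA.1.
Qed.

Let halflineII A : spec_set A -> halfline `&` halfline `&` A = A.
Proof. by move=> [_ AH]; rewrite setIid setIC; exact/setIidPl. Qed.

Let inner_rho A u w : spec_set A -> L2 u -> L2 w ->
  inner u (G A w) = inner (G A u) (G A w).
Proof. by move=> sA Lu Lw; rewrite inner_spec2// setIid spec_sym. Qed.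

(* E_{g, G_A g}(B) = |G_(A & B) g|^2 is a positive measure carried by A, so
   <rho g, G_A g> >= b |G_A g|^2; conclude by Cauchy-Schwarz. *)
Lemma spec_rho_ge A b g : spec_set A -> 0 <= b -> (forall x, A x -> b <= x) ->
  L2 g -> L2 (rmul rho g) -> b ^+ 2 * nrm2 (G A g) <= nrm2 (G A (rmul rho g)).
Proof.
move=> sA b0 bA Lg Lrg; have LAg := G_L2 sA Lg; have LArg := G_L2 sA Lrg.
have [mA AH] := sA.
have nu_ge0 B : measurable B -> B `<=` halfline -> 0 <= complex.Re (spec_form G g (G A g) B).
  move=> mB _; rewrite spec_formE//=; apply: nrm2_ge0.
  by apply: G_L2 => //; apply: spec_setIl mA; exact: spec_set_halfline.
have nu0 B : measurable B -> B `<=` halfline `\` A -> complex.Re (spec_form G g (G A g) B) = 0.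
  move=> mB BA; rewrite spec_formE//= nrm2_spec0//.
  by apply/seteqP; split => // x [[/BA[_ +] _]].
have := has_cintegral_ge measurable_halfline mA AH nu_ge0 nu0 bA (Grho Lg Lrg LAg).
rewrite spec_formE ?halflineII//; last exact: measurable_halfline.
rewrite cReC.
rewrite inner_rho//.
have := inner_cauchy_schwarz LArg LAg; rewrite sqr_normc.
have := nrm2_ge0 LAg; have := nrm2_ge0 LArg.
set M := nrm2 (G A (rmul rho g)); set N := nrm2 (G A g).
set r := complex.Re _; set i := complex.Im _ => M0 N0 hri hr.
have [N_eq0|Nneq0] := eqVneq N 0; first by rewrite N_eq0 mulr0.
have Np : 0 < N by rewrite lt_neqAle eq_sym Nneq0.
have bN0 : 0 <= b * N by rewrite mulr_ge0.
have : (b * N) ^+ 2 <= r ^+ 2 by rewrite ler_pXn2r ?nnegrE// (le_trans bN0).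
move=> h1; have h2 : (b ^+ 2 * N) * N <= M * N.
  by have := sqr_ge0 i; rewrite exprMn in h1; nra.
by rewrite -(ler_pM2r Np).
Qed.

(** The measure E_{g, G_A g} is real, nonnegative and carried by A, a subset of [0, +oo[ on which x
    <= c. The integral of x against it is thus real and lies between 0 and c |G_A g|^2. *)
Let form_rho_bound A c g : spec_set A -> (forall x, A x -> x <= c) ->
  L2 g -> L2 (rmul rho g) ->
  exists2 q : R, inner (rmul rho g) (G A g) = q%:C & 0 <= q <= c * nrm2 (G A g).
Proof.
move=> sA Ac Lg Lrg; have LAg := G_L2 sA Lg.
have [mA AH] := sA; have mH := @measurable_halfline R.
have hz := Grho Lg Lrg LAg.
have nu_ge0 B : measurable B -> B `<=` halfline -> 0 <= complex.Re (spec_form G g (G A g) B).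
  move=> mB _; rewrite spec_formE//=; apply: nrm2_ge0.
  by apply: G_L2 => //; apply: spec_setIl mA; exact: spec_set_halfline.
have nu0 B : measurable B -> B `<=` halfline `\` A -> complex.Re (spec_form G g (G A g) B) = 0.
  move=> mB BA; rewrite spec_formE//= nrm2_spec0//.
  by apply/seteqP; split => // x [[/BA[_ +] _]].
have im0 : complex.Im (inner (rmul rho g) (G A g)) = 0.
  by apply: has_cintegral_Im0 mH _ hz => B mB _; rewrite spec_formE.
exists (complex.Re (inner (rmul rho g) (G A g))).
  by apply: complexP.
apply/andP; split.
  have H0 x : halfline x -> (0 : R) <= id x by rewrite /halfline /= in_itv/= andbT.
  have DD B : measurable B -> B `<=` halfline `\` halfline ->
      complex.Re (spec_form G g (G A g) B) = 0.
    by move=> mB; rewrite setDv subset0 => ->; rewrite spec_formE//= nrm2_spec0// !set0I.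
  have := has_cintegral_ge mH mH (@subset_refl _ _) nu_ge0 DD H0 hz.
  by rewrite mul0r.
have := has_cintegral_le mH mA AH nu_ge0 nu0 Ac hz.
by rewrite spec_formE ?halflineII.
Qed.

(* Cauchy-Schwarz for the positive form q(u, w) = <rho u, G_A w>, which satisfies
   q(u, u) <= c |G_A u|^2, applied to u = g and w = rho g. *)
Lemma spec_rho_le A c g : spec_set A -> 0 <= c -> (forall x, A x -> x <= c) ->
  L2 g -> L2 (rmul rho g) -> L2 (rmul rho (rmul rho g)) ->
  nrm2 (G A (rmul rho g)) <= c ^+ 2 * nrm2 (G A g).
Proof.
move=> sA c0 Ac Lg Lw Lrw; set w := rmul rho g in Lw Lrw *.
have LAg := G_L2 sA Lg; have LAw := G_L2 sA Lw.
have [q1 q1E /andP[q10 q1c]] := form_rho_bound sA Ac Lg Lw.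
have [q2 q2E /andP[q20 q2c]] := form_rho_bound sA Ac Lw Lrw.
have cs : Normc.normc (inner w (G A w)) ^+ 2 <= q1 * q2.
  (* The form is q(t g + w, t g + w), real and nonnegative by [form_rho_bound]. Its cross
     coefficient <rho g, G_A w> equals |G_A w|^2 because w = rho g. *)
  apply: (psd_form_cauchy_schwarz (z' := inner (rmul rho w) (G A g))) => // t.
  have Lt := L2_lin t Lg Lw.
  have rt : rmul rho (fun x => t * g x + w x) = (fun x => t * w x + rmul rho w x).
    by apply/funext => x; rewrite /w /rmul; ring.
  have Lrt : L2 (rmul rho (fun x => t * g x + w x)) by rewrite rt; exact: L2_lin.
  have [q qE /andP[q0 _]] := form_rho_bound sA Ac Lt Lrt.
  exists q => //; rewrite -qE rt -q1E -q2E.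
  have LAt := L2_lin t LAg LAw.
  have LrAt : L2 (fun x => t * w x + rmul rho w x) by exact: L2_lin.
  transitivity (inner (fun x => t * w x + rmul rho w x) (fun x => t * G A g x + G A w x)).
    by rewrite inner_linl// !inner_linr//; ring.
  apply: inner_ae_L2 => //; first exact: G_L2.
  by apply: ae_equal_sym; exact: spec_lin.
rewrite inner_rho// in cs; rewrite inner_nrm2// normc_real real_normK ?num_real// in cs.
have := nrm2_ge0 LAg; have := nrm2_ge0 LAw; move: q1c q2c cs.
set M := nrm2 (G A w); set N := nrm2 (G A g) => h1 h2 h3 M0 N0.
have h4 : M ^+ 2 <= (c ^+ 2 * N) * M.
  apply: le_trans h3 _; rewrite (_ : _ * M = (c * N) * (c * M)); last by ring.
  by rewrite ler_pM.
have [M_eq0|Mneq0] := eqVneq M 0; first by rewrite M_eq0 mulr_ge0// sqr_ge0.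
by rewrite -(@ler_pM2r _ M)// lt_neqAle eq_sym Mneq0.
Qed.

Lemma spec_gt_supp_le A a b g : spec_set A -> 0 <= a -> a < b ->
  (forall x, A x -> b <= x) -> L2 g -> (forall x, g x != 0 -> rho x <= a) ->
  ae_equal (G A g) (fun=> 0).
Proof.
move=> sA a0 ab bA Lg ga; have LAg := G_L2 sA Lg.
have b0 : 0 < b by exact: le_lt_trans ab.
pose gk k := rmul (fun x => rho x ^+ k) g.
have mk k : measurable_fun setT (fun x => rho x ^+ k) by exact: measurable_funX.
have bk k x : g x != 0 -> `|rho x ^+ k| <= a ^+ k.
  by move=> /ga ra; rewrite normrX ger0_norm// lerXn2r ?nnegrE.
have Lk k : L2 (gk k) by apply: L2_rmul (bk k).
have rk k : rmul rho (gk k) = gk k.+1.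
  by apply/funext => x; rewrite /gk /rmul mulrA -rmorphM /= -exprS.
apply: nrm2_eq0 => //; apply/eqP; rewrite eq_le nrm2_ge0// andbT.
have it k : (b ^+ 2) ^+ k * nrm2 (G A g) <= nrm2 (G A (gk k)).
  elim: k => [|k ih].
    rewrite expr0 mul1r (_ : gk 0%N = g)//.
    by apply/funext => x; rewrite /gk /rmul expr0 mul1r.
  rewrite exprS -mulrA; apply: le_trans (_ : b ^+ 2 * nrm2 (G A (gk k)) <= _).
    by rewrite ler_wpM2l// sqr_ge0.
  by rewrite -rk; apply: spec_rho_ge (ltW b0) bA _ _ => //; rewrite rk.
apply: (@geometric_le0 _ ((a / b) ^+ 2) _ (nrm2 g)).
- by rewrite sqr_ge0.
- rewrite -(expr1n _ 2) ltr_pXn2r// ?nnegrE ?divr_ge0 ?(ltW b0)//.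
  by rewrite ltr_pdivrMr ?mul1r.
move=> k; rewrite -exprM mulnC exprM expr_div_n expr_div_n mulrAC.
rewrite ler_pdivlMr ?exprn_gt0// mulrC -exprM mulnC exprM.
apply: le_trans (it k) _; apply: le_trans (nrm2_spec_le hG sA (Lk k)) _.
exact: nrm2_rmul_le (bk k).
Qed.

(* The iteration starts at rho^-1 g rather than g because [spec_rho_le] needs
   two powers of rho to stay in L^2; G_A (rho^-1 g) = 0 then forces G_A g = 0. *)
Lemma spec_le_supp_gt A c a g : spec_set A -> 0 <= c -> c < a ->
  (forall x, A x -> x <= c) -> L2 g -> (forall x, g x != 0 -> a < rho x) ->
  ae_equal (G A g) (fun=> 0).
Proof.
move=> sA c0 ca Ac Lg ga.
have a0 : 0 < a by exact: le_lt_trans ca.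
pose gk k := rmul (fun x => (rho x)^-1 ^+ k) g.
have mV : measurable_fun setT (fun x => (rho x)^-1).
  (* As rho >= 0, its inverse is the real power of exponent -1, a measurable function of rho. *)
  rewrite (_ : (fun _ => _) = (fun x => rho x `^ (- 1))).
    exact: (measurableT_comp (measurable_powR (- 1))).
  by apply/funext => x; rewrite powRN powRr1.
have mk k : measurable_fun setT (fun x => (rho x)^-1 ^+ k) by exact: measurable_funX.
have bk k x : g x != 0 -> `|(rho x)^-1 ^+ k| <= a^-1 ^+ k.
  move=> /ga ra; rewrite normrX ger0_norm ?invr_ge0// lerXn2r ?nnegrE ?invr_ge0// ?(ltW a0)//.
  by rewrite lef_pV2 ?posrE ?(ltW ra)// (lt_trans a0).
have Lk k : L2 (gk k) by apply: L2_rmul (bk k).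
have rk k : rmul rho (gk k.+1) = gk k.
  apply/funext => x; rewrite /gk /rmul mulrA -rmorphM /= exprS mulrA.
  have [->|/ga ra] := eqVneq (g x) 0; first by rewrite !mulr0.
  by rewrite mulfV ?mul1r// gt_eqF// (lt_trans a0).
have g0 : gk 0%N = g.
  by apply/funext => x; rewrite /gk /rmul expr0 mul1r.
have LA1 := G_L2 sA (Lk 1%N).
have A1 : ae_equal (G A (gk 1%N)) (fun=> 0).
  apply: nrm2_eq0 => //; apply/eqP; rewrite eq_le nrm2_ge0// andbT.
  have it k : nrm2 (G A (gk 1%N)) <= (c ^+ 2) ^+ k * nrm2 (G A (gk k.+1)).
    elim: k => [|k ih]; first by rewrite expr0 mul1r.
    rewrite exprSr -mulrA; apply: le_trans ih _.
    rewrite ler_wpM2l ?exprn_ge0 ?sqr_ge0//.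
    rewrite -[in leLHS]rk; apply: spec_rho_le => //; rewrite ?rk//.
  apply: (@geometric_le0 _ ((c / a) ^+ 2) _ (nrm2 (gk 1%N))).
  - by rewrite sqr_ge0.
  - rewrite -(expr1n _ 2) ltr_pXn2r// ?nnegrE ?divr_ge0 ?(ltW a0)//.
    by rewrite ltr_pdivrMr ?mul1r.
  move=> k; apply: le_trans (it k) _; rewrite expr_div_n expr_div_n -mulrA.
  rewrite ler_wpM2l ?exprn_ge0 ?sqr_ge0//.
  apply: le_trans (nrm2_spec_le hG sA (Lk k.+1)) _.
  have gkE : gk k.+1 = rmul (fun x => (rho x)^-1 ^+ k) (gk 1%N).
    by apply/funext => x; rewrite /gk /rmul mulrA -rmorphM /= exprSr expr1.
  rewrite gkE -exprM mulnC exprM -exprVn.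
  apply: le_trans (nrm2_rmul_le (mk k) (Lk 1%N) (K := a^-1 ^+ k) _) _.
    move=> x; rewrite /gk /rmul mulf_eq0 negb_or => /andP[_]; exact: bk.
  by rewrite exprVn.
apply: inner_ext => [||w Lw]; [exact: G_L2|exact: L2_0|].
have LAw := G_L2 sA Lw.
(* Since g = rho (rho^-1 g), <g, G_A w> is the integral of x against the set function sending B to
   <G_(A & B) (rho^-1 g), w>, which vanishes because G_A (rho^-1 g) = 0. *)
rewrite inner0l// spec_sym// -[X in inner X _]g0 -rk.
have Lr1 : L2 (rmul rho (gk 1%N)) by rewrite rk.
apply: has_cintegral0 (@measurable_halfline R) _ (Grho (Lk 1%N) Lr1 LAw) => B mB BH.
have sB := spec_set_halfline mB.
rewrite /spec_form inner_spec2// setIC -(inner0l Lw).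
apply: inner_ae_L2 => //; [exact: G_L2 (spec_setIl sA sB.1) (Lk 1%N)|exact: L2_0|].
rewrite setIC; apply: ae_equal_trans (spec_setI hG sB.1 sB.2 sA.1 sA.2 (Lk 1%N)) _.
apply: ae_equal_trans (spec_set0_ae hG (Lk 1%N)).
have LBA : L2 (G (B `&` halfline) (G A (gk 1%N))) by exact: G_L2.
have := spec_ae hG sB LA1 (@L2_0 R n) A1.
move=> h1; apply: ae_equal_trans h1 _.
apply: ae_equal_trans (ae_equal_sym (spec_set0_ae hG (Lk 1%N))) => //.
(* Linearity with a = -1 and u = v = 0 gives G_B 0 = - G_B 0 + G_B 0 = 0. *)
have := spec_lin hG (-1) sB (@L2_0 R n) (@L2_0 R n).
by apply: filterS => x; rewrite mulr0 addr0 mulN1r addNr => ->.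
Qed.

Local Notation ind B := (fun x : T => \1_B (rho x) : R).

Let measurable_ind B : measurable B -> measurable_fun setT (ind B).
Proof. by move=> mB; apply: measurableT_comp mrho; exact: measurable_indic. Qed.

Let ind_le1 B x : `|ind B x| <= 1.
Proof. by rewrite /= indicE; case: (_ \in _); rewrite ?normr1 ?normr0. Qed.

Let L2_ind B u : measurable B -> L2 u -> L2 (rmul (ind B) u).
Proof.
by move=> mB Lu; apply: (L2_rmul (K := 1) (measurable_ind mB) Lu) => x _; exact: ind_le1.
Qed.

Let ind_supp B u x : rmul (ind B) u x != 0 -> B (rho x).
Proof.
rewrite /rmul/= indicE; case: (boolP (_ \in _)) => [/set_mem//|_].
by rewrite mul0r eqxx.
Qed.

(** The factor 1 gives the sum the shape a u + v expected by [spec_lin]. *)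
Let split_ind B u : u = (fun x => 1 * rmul (ind (~` B)) u x + rmul (ind B) u x).
Proof.
by apply/funext => x; rewrite /rmul/= !indicE in_setC mul1r; case: (_ \in _);
  rewrite /= ?(mul0r, mul1r, add0r, addr0).
Qed.

(** The two vanishing lemmas need a gap between the spectral set and the support. For I = ]a, +oo[
    and functions supported in rho <= a, the gap is made on the spectral side, by exhausting I with
    the rays [a + 1/(k+1), +oo[. For J = [0, a] and functions supported in rho > a, it is made on
    the function side, by exhausting the support. *)
Lemma spec_ray a u : 0 <= a -> L2 u ->
  ae_equal (G `]a, +oo[ u) (rmul (ind `]a, +oo[) u).
Proof.
move=> a0 Lu; pose I : set := `]a, +oo[%classic; pose J : set := `[0, a]%classic.
have mI : measurable I by exact: measurable_itv.
have mJ : measurable J by exact: measurable_itv.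
have sI : spec_set I.
  by split=> // x; rewrite /I /halfline /= !in_itv/= !andbT => /ltW; exact: le_trans.
have sJ : spec_set J.
  by split=> // x; rewrite /J /halfline /= !in_itv/= andbT => /andP[].
have G_I_le v : L2 v -> ae_equal (G I (rmul (ind (~` I)) v)) (fun=> 0).
  move=> Lv; have LCv : L2 (rmul (ind (~` I)) v) by apply: L2_ind => //; exact: measurableC.
  pose F (k : nat) : set := `[a + k.+1%:R^-1, +oo[%classic.
  have sF k : spec_set (F k).
    split; first exact: measurable_itv.
    move=> x; rewrite /F /halfline /= !in_itv/= !andbT; apply: le_trans.
    by rewrite addr_ge0 ?invr_ge0.
  (* The rays increase; [seqDU] makes them disjoint, as additivity requires. *)
  have IE : I = \bigcup_k seqDU F k by rewrite -seqDU_bigcup_eq /I itvoyEbigcup.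
  rewrite [X in G X]IE; apply: (spec_bigcup0 hG _ _ LCv) => [k||k].
  - by split; [apply: seqDU_measurable => j; exact: (sF j).1|move=> x [/(sF k).2]].
  - exact: trivIset_seqDU.
  have sDk : spec_set (seqDU F k).
    by split; [apply: seqDU_measurable => j; exact: (sF j).1|move=> x [/(sF k).2]].
  apply: (spec_gt_supp_le (a := a) (b := a + k.+1%:R^-1) sDk a0 _ _ LCv).
  - by rewrite ltrDl invr_gt0.
  - by move=> x [+ _]; rewrite /F /= in_itv/= andbT.
  - by move=> x /ind_supp; rewrite /I /= in_itv/= andbT => /negP; rewrite -leNgt.
have G_J_gt v : L2 v -> ae_equal (G J (rmul (ind I) v)) (fun=> 0).
  (* On the adjoint side the claim is that 1_I G_J v = 0, which follows pointwise from 1_(F k) G_J v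
     = 0 for all k. No limit has to pass through G_J. *)
  move=> Lv; apply: (rmul_spec0_sym hG sJ (measurable_ind mI) (ind_le1 I) _ Lv) => {Lv}v Lv.
  pose F (k : nat) : set := `]a + k.+1%:R^-1, +oo[%classic.
  have FI k : ae_equal (rmul (ind (F k)) (G J v)) (fun=> 0).
    have mF : measurable (F k) by exact: measurable_itv.
    apply: (spec_rmul0_sym hG sJ (measurable_ind mF) (ind_le1 _) _ Lv) => w Lw.
    have LFw := L2_ind mF Lw.
    apply: (spec_le_supp_gt (c := a) (a := a + k.+1%:R^-1) sJ a0 _ _ LFw).
    - by rewrite ltrDl invr_gt0.
    - by move=> x; rewrite /J /= in_itv/= => /andP[].
    - by move=> x /ind_supp; rewrite /F /= in_itv/= andbT.
  apply: filterS (ae_foralln FI) => x Fx.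
  rewrite /rmul/= indicE; case: (boolP (_ \in _)) => [|_]; last by rewrite mul0r.
  rewrite inE /I /= in_itv/= andbT => ax.
  have [k ak] : exists k : nat, a + k.+1%:R^-1 < rho x.
    have ra : 0 < rho x - a by rewrite subr_gt0.
    have [k _ hk] := near_infty_natSinv_lt (PosNum ra).
    by exists k; rewrite -ltrBrDl; exact: (hk k (leqnn k)).
  have := Fx k; rewrite /rmul/= indicE mem_set ?mul1r//.
  by rewrite /F /= in_itv/= andbT.
have mCI := measurableC mI.
have LI := L2_ind mI Lu; have LCI := L2_ind mCI Lu.
have HE : halfline = J `|` I :> set.
  apply/seteqP; split => x; rewrite /halfline /J /I /= !in_itv/= !andbT.
    by move=> x0; case: (leP x a) => xa; [left; rewrite x0|right].
  by move=> [/andP[]//|/ltW]; exact: le_trans.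
have JI0 : J `&` I = set0.
  apply/seteqP; split => // x; rewrite /J /I /= !in_itv/= !andbT => -[/andP[_ xa]].
  by rewrite ltNge xa.
(* G_I and G_J add up to the identity, and G_J kills 1_I u. *)
have eqI : ae_equal (G I (rmul (ind I) u)) (rmul (ind I) u).
  have h1 := spec_setT hG LI; rewrite HE in h1.
  have h2 := spec_setU2 hG sJ sI JI0 LI.
  apply: filterS3 h1 h2 (G_J_gt _ Lu) => x E1 E2 E3.
  by rewrite -[RHS]E1 E2 E3 add0r.
have h1 := spec_lin hG 1 sI LCI LI.
rewrite -(split_ind I u) in h1.
apply: filterS3 h1 eqI (G_I_le _ Lu) => x -> -> ->.
by rewrite mulr0 add0r.
Qed.

(** Dynkin's lemma on open rays. For a disjoint union U of sets F_k, comparing an L^2 limit with a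
    pointwise sum is avoided: additivity gives G_U (1_(~U) v) = 0, hence 1_(~U) G_U u = 0 by
    self-adjointness, while 1_(F_k) G_U u = G_(F_k) G_U u = G_(F_k) u = 1_(F_k) u. The sets ~U and
    F_k cover the line, so G_U u is known everywhere. *)
Theorem spec_eq_indicator B u : measurable B -> L2 u ->
  ae_equal (G (B `&` halfline) u) (rmul (ind B) u).
Proof.
move=> mB; move: B mB u.
pose P (B : set) := forall u, L2 u -> ae_equal (G (B `&` halfline) u) (rmul (ind B) u).
have ME := RGenOInfty.measurableE R.
suff H : forall B, <<s @RGenOInfty.G R >> B -> P B.
  by move=> B mB; apply: H; rewrite -[X in X B]ME.
apply: dynkin_induction => //.
- move=> _ _ [x ->] [y ->]; exists (Num.max x y).
  by apply/seteqP; split => z; rewrite /= !in_itv/= !andbT gt_max => /andP.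
- move=> u Lu; rewrite setTI; apply: filterS (spec_setT hG Lu) => x ->.
  by rewrite /rmul/= indicT mul1r.
- move=> _ [a ->] u Lu; have [a0|a0] := leP 0 a.
    rewrite (_ : _ `&` _ = `]a, +oo[%classic); first exact: spec_ray.
    apply/setIidPl => x; rewrite /halfline /= !in_itv/= !andbT => /ltW; exact: le_trans.
  (* For a < 0 the ray contains [0, +oo[, where rho takes its values, so both sides are u. *)
  rewrite (_ : _ `&` _ = halfline); last first.
    by apply/setIidPr => x; rewrite /halfline /= !in_itv/= !andbT; exact: lt_le_trans.
  apply: filterS (spec_setT hG Lu) => x ->.
  by rewrite /rmul/= indicE mem_set ?mul1r//= in_itv/= andbT (lt_le_trans a0).
- move=> B mB PB u Lu.
  have sB := spec_set_halfline mB; have sCB := spec_set_halfline (measurableC mB).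
  have HE : (~` B `&` halfline) `|` (B `&` halfline) = halfline.
    by rewrite -setIUl setvU setTI.
  have D0 : (~` B `&` halfline) `&` (B `&` halfline) = set0.
    by rewrite setIACA setICl set0I.
  have h := spec_setU2 hG sCB sB D0 Lu; rewrite HE in h.
  apply: filterS3 h (spec_setT hG Lu) (PB _ Lu) => x E1 E2 E3.
  move: E1; rewrite E2 E3 => /eqP; rewrite -subr_eq => /eqP <-.
  by rewrite /rmul/= !indicE in_setC; case: (_ \in _); rewrite /= ?(mul0r, mul1r, subr0, subrr).
move=> F mF tF PF u Lu; set U := \bigcup_k F k.
have mU : measurable U by exact: bigcupT_measurable.
have sU := spec_set_halfline mU; have sF k := spec_set_halfline (mF k).
have LU := G_L2 sU Lu.
have GZ v : L2 v -> ae_equal (G (U `&` halfline) (rmul (ind (~` U)) v)) (fun=> 0).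
  move=> Lv; have LZ := L2_ind (measurableC mU) Lv.
  rewrite setI_bigcupl; apply: (spec_bigcup0 hG) => // [|k].
    exact: trivIset_setIr.
  apply: filterS (PF k _ LZ) => x ->; rewrite /rmul/= !indicE in_setC.
  case: (boolP (_ \in F k)) => [|_]; last by rewrite mul0r.
  by rewrite inE => Fk; rewrite [_ \in U]mem_set ?mul0r ?mulr0//; exists k.
have ZG := spec_rmul0_sym hG sU (measurable_ind (measurableC mU)) (ind_le1 _) GZ Lu.
have FG k : ae_equal (rmul (ind (F k)) (G (U `&` halfline) u)) (rmul (ind (F k)) u).
  have h1 := PF k _ LU; have h2 := PF k _ Lu.
  have := spec_setI hG (sF k).1 (sF k).2 sU.1 sU.2 Lu.
  rewrite setIACA setIid (_ : F k `&` U = F k); last first.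
    by apply/setIidPl; exact: bigcup_sup.
  by apply: filterS3 h1 h2 => x -> -> ->.
apply: filterS2 ZG (ae_foralln FG) => x Z0 Fx.
rewrite /rmul/= indicE; case: (boolP (_ \in _)) => [|xU].
  rewrite inE => -[k _ Fk]; rewrite mul1r.
  by have := Fx k; rewrite /rmul/= indicE mem_set// !mul1r.
by rewrite mul0r; move: Z0; rewrite /rmul/= indicE in_setC xU mul1r.
Qed.

End spectral_uniqueness.

(** * Integration by parts *)

Section rV_borel.
Context {R : realType}.

(** Measurable sets are generated by the coordinates, so second countability is what links them to
    the topology: U is the union of the open cubes with rational centre and radius 1/(k+1) that it
    contains. *)
Lemma measurable_open_rV n (U : set 'rV[R]_n) : open U -> measurable U.
Proof.
move=> oU.
pose B (p : 'rV[rat]_n * nat) : set 'rV[R]_n :=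
  [set v | forall i, `|v ord0 i - ratr (p.1 ord0 i)| < p.2.+1%:R^-1].
have mB p : measurable (B p).
  rewrite (_ : B p = ~` \bigcup_i ~` ((fun v : 'rV[R]_n => v ord0 i : measurableTypeR R) @^-1`
      ball (ratr (p.1 ord0 i) : R) p.2.+1%:R^-1)); last first.
    rewrite setC_bigcup; apply/seteqP; split => v /=.
      by move=> Bv i _; rewrite setCK /= -ball_normE /= distrC; exact: Bv.
    by move=> Bv i; have := Bv i I; rewrite setCK /= -ball_normE /= distrC.
  apply: measurableC; apply: countable_bigcupT_measurable => [|i]; first exact: countableP.
  apply: measurableC; rewrite -[X in measurable X]setTI; apply: measurable_rV_coord => //.
  exact: measurable_ball.
rewrite (_ : U = \bigcup_p (if pselect (B p `<=` U) then B p else set0)).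
  apply: countable_bigcupT_measurable => [|p]; first exact: countableP.
  by case: pselect => _ /=; [exact: mB|exact: measurable0].
apply/seteqP; split => [x Ux|x [p _]]; last by case: pselect => // BU /BU.
have /nbhs_ballP[e /= e0 xeU] := open_nbhs_nbhs (conj oU Ux).
(* A cube of radius below e/2 that contains x lies in the sup-norm ball of radius e around x. *)
have e20 : 0 < e / 2 by rewrite divr_gt0.
have [k _ /(_ k (leqnn k))/= ke] := near_infty_natSinv_lt (PosNum e20).
have [q hq] : {q : 'I_n -> rat & forall i, `|x ord0 i - ratr (q i)| < k.+1%:R^-1}.
  apply: (@choice _ _ (fun i (r : rat) => `|x ord0 i - ratr r| < k.+1%:R^-1)) => i.
  have /rat_in_itvoo[q] : x ord0 i < x ord0 i + k.+1%:R^-1 by rewrite ltrDl invr_gt0.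
  have d0 : 0 < k.+1%:R^-1 :> R by rewrite invr_gt0.
  rewrite in_itv/= => /andP[xq qx]; exists q.
  rewrite ltr_norml ltrNl opprB ltrBlDl qx/=.
  by rewrite (lt_trans _ d0)// subr_lt0.
exists (\row_i q i, k) => //=; case: pselect => [_ i|nBU] /=; first by rewrite mxE.
exfalso; apply: nBU => y By; apply: xeU; split => // i j; rewrite (ord1 i) -ball_normE /=.
have := By j; rewrite mxE => yq; have xq := hq j.
rewrite -(subrKA (ratr (q j))) (le_lt_trans (ler_normD _ _))// (splitr e).
by rewrite ltrD// ?(lt_trans xq)// distrC (lt_trans yq).
Qed.

Lemma continuous_measurable_rV n (f : 'rV[R]_n -> R) :
  continuous f -> measurable_fun setT f.
Proof.
move=> cf; apply: (measurability _ (RGenOInfty.measurableE R)) => //.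
move=> _ [_ [x ->] <-]; rewrite setTI; apply: measurable_open_rV.
by move/continuousP : cf => /(_ `]x, +oo[%classic); apply; exact: interval_open.
Qed.

(** Closed cubes bound the supports: every compact set lies in one, and a cube splits as a product
    along [rV_cons], as inductions on the dimension require. *)
Definition box n (M : R) : set 'rV[R]_n := [set v | forall i, `|v ord0 i| <= M].

Lemma measurable_box n M : measurable (@box n M).
Proof.
rewrite (_ : box M = ~` \bigcup_i ~` ((fun v : 'rV[R]_n => v ord0 i : measurableTypeR R) @^-1`
    `[- M, M]%classic)); last first.
  rewrite setC_bigcup; apply/seteqP; split => v /=.
    by move=> Bv i _; rewrite setCK /= in_itv/= -ler_norml.
  by move=> Bv i; have := Bv i I; rewrite setCK /= in_itv/= -ler_norml.
apply: measurableC; apply: countable_bigcupT_measurable => [|i]; first exact: countableP.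
apply: measurableC; rewrite -[X in measurable X]setTI.
by apply: measurable_rV_coord.
Qed.

Lemma compact_box n M : compact (@box n M).
Proof.
rewrite (_ : box M = [set v | forall i, `[- M, M]%classic (v ord0 i)]).
  apply: (@rV_compact _ _ (fun=> `[- M, M]%classic)) => _; exact: segment_compact.
by apply/seteqP; split => v h i; have := h i; rewrite /= in_itv/= -ler_norml.
Qed.

Lemma leb_box n M : (leb n (@box n M) < +oo)%E.
Proof.
elim: n => [|n ih]; first by rewrite /= diracE; case: (_ \in _); rewrite ltry.
rewrite /= /lebesgue_step /pushforward.
rewrite (_ : _ @^-1` _ = `[- M, M]%classic `*` box M); last first.
  apply/seteqP; split => -[t v] /=.
    move=> h; split; first by have := h ord0; rewrite rV_cons0 in_itv/= -ler_norml.
    by move=> i; have := h (lift ord0 i); rewrite rV_consS.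
  move=> [ht hv] i; case: (unliftP ord0 i) => [j ->|->].
    by rewrite rV_consS; exact: hv.
  by rewrite rV_cons0; move: ht; rewrite in_itv/= -ler_norml.
rewrite product_measure1E//; last exact: measurable_box.
have fI : (@lebesgue_measure R (`[- M, M]%classic)%R < +oo)%E.
  by rewrite lebesgue_measure_itv/=; case: ifP; rewrite ?ltry.
by apply: lte_mul_pinfty => //; rewrite ge0_fin_numE.
Qed.

Lemma continuous_box_integrable n (f : 'rV[R]_n -> R) M : continuous f ->
  (forall x, ~ box M x -> f x = 0) -> (leb n).-integrable setT (EFin \o f).
Proof.
move=> cf f0; rewrite (_ : EFin \o f = (EFin \o f) \_ (box M)); last first.
  apply/funext => x; rewrite /patch; case: ifPn => //; rewrite notin_setE => /f0 /= ->.
  by [].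
have mbox := @measurable_box n M.
apply/(integrable_mkcond _ mbox).
apply: measurable_bounded_integrable => //; first exact: leb_box.
  by apply: measurable_funTS; exact: continuous_measurable_rV.
have /compact_bounded : compact (f @` box M).
  by apply: continuous_compact; [exact: continuous_subspaceT|exact: compact_box].
move=> [C [Cr fC]]; exists C; split => // D CD x bx.
by apply: (fC D CD); exists x.
Qed.

End rV_borel.

Section partial_derivatives.
Context {R : realType}.

Lemma coord_le_norm n (x : 'rV[R]_n) i : `|x ord0 i| <= `|x|.
Proof.
have /mapP[j Hj ->] : `|x ord0 i| \in [seq `|x v.1 v.2| | v : 'I_1 * 'I_n].
  by apply/mapP; exists (ord0, i) => //=; rewrite mem_enum.
by rewrite [leRHS]/Num.norm /= mx_normrE; apply/bigmax_geP; right => /=; exists j.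
Qed.

Lemma continuous_funD (U : topologicalType) (f g : U -> R) :
  continuous f -> continuous g -> continuous (fun x => f x + g x).
Proof. by move=> cf cg x; apply: continuousD; [exact: cf|exact: cg]. Qed.

Lemma continuous_funM (U : topologicalType) (f g : U -> R) :
  continuous f -> continuous g -> continuous (fun x => f x * g x).
Proof. by move=> cf cg x; apply: continuousM; [exact: cf|exact: cg]. Qed.

(** Both difference quotients are the same function of the increment. Partial derivatives of waves
    are thereby reduced to the one-variable chain rule. *)
Lemma is_derive_line n (f : 'rV[R]_n -> R) x v (d : R) :
  is_derive (0 : R) 1 (fun t => f (t *: v + x)) d -> is_derive x v f d.
Proof.
move=> [dex dval]; split; first exact/derivable1P.
rewrite -dval /derive.
suff -> : (fun h : R => h^-1 *: ((f \o shift x) (h *: v) - f x)) =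
  (fun h : R => h^-1 *: (((fun t => f (t *: v + x)) \o shift 0) (h *: 1) - f (0 *: v + x))) by [].
by apply/funext => h /=; rewrite addr0 scale0r add0r [_%:A]mulr1.
Qed.

Lemma near_not_box n (x : 'rV[R]_n) M : ~ box M x -> \near x, ~ box M x.
Proof.
move=> /existsNP[i /negP]; rewrite -ltNge => Mx.
apply/nbhs_ballP; exists (`|x ord0 i| - M); first by rewrite /= subr_gt0.
move=> y [_ /(_ ord0 i)]; rewrite -ball_normE /= => xy /(_ i).
apply/negP; rewrite -ltNge.
have := lerB_dist (x ord0 i) (y ord0 i); lra.
Qed.

Lemma partial_off_box n (i : 'I_n) (f : 'rV[R]_n -> R) M :
  (forall x, ~ box M x -> f x = 0) -> forall x, ~ box M x -> partial i f x = 0.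
Proof.
move=> f0 x nx; rewrite /partial (@near_eq_derive _ _ _ f (cst 0)); first exact: derive_cst.
by apply: filterS (near_not_box nx) => y /f0 ->.
Qed.

Lemma rV_cons_continuousl n (y : 'rV[R]_n) : continuous (fun t : R => rV_cons (t, y)).
Proof.
move=> t; apply/cvg_ballP => e e0; near=> s; split=> // j i; rewrite (ord1 j).
case: (unliftP ord0 i) => [k ->|->]; first by rewrite !rV_consS; exact: ballxx.
by rewrite !rV_cons0 /=; near: s; by apply/nbhs_ballP; exists e.
Unshelve. all: by end_near. Qed.

Lemma rV_cons_continuousr n (t : R) : continuous (fun y : 'rV[R]_n => rV_cons (t, y)).
Proof.
move=> y A /nbhs_ballP[e /= e0 eA]; apply/nbhs_ballP; exists e => // z yz; apply: eA.
split=> // j i; rewrite (ord1 j).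
case: (unliftP ord0 i) => [k ->|->]; last by rewrite !rV_cons0; exact: ballxx.
by rewrite !rV_consS /=; exact: yz.2.
Qed.

Lemma rV_cons_shift0 n (t h : R) (y : 'rV[R]_n) :
  h *: delta_mx ord0 ord0 + rV_cons (t, y) = rV_cons (h + t, y).
Proof.
apply/rowP => i; rewrite !mxE eqxx /=.
by case: (unliftP ord0 i) => [k ->|->]; rewrite ?eqxx ?mulr1// mulr0 add0r.
Qed.

Lemma rV_cons_shiftS n (t h : R) (y : 'rV[R]_n) (j : 'I_n) :
  h *: delta_mx ord0 (lift ord0 j) + rV_cons (t, y) =
  rV_cons (t, h *: delta_mx ord0 j + y).
Proof.
apply/rowP => i; rewrite !mxE eqxx /=.
case: (unliftP ord0 i) => [k ->|->] /=; last by rewrite mulr0 add0r.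
by rewrite !mxE eqxx /= (inj_eq lift_inj).
Qed.

Lemma integral_leb_cons n (f : 'rV[R]_n.+1 -> R) :
  (leb n.+1).-integrable setT (EFin \o f) ->
  (@lebesgue_measure R \x leb n)%E.-integrable setT (EFin \o (f \o rV_cons)) /\
  (\int[leb n.+1]_x (f x)%:E =
   \int[(@lebesgue_measure R \x leb n)%E]_z (f (rV_cons z))%:E)%E.
Proof.
move=> fi; have mc := @measurable_rV_cons R n.
have mf : measurable_fun setT f by move: fi => /integrableP[/measurable_EFinP].
have fci : (@lebesgue_measure R \x leb n)%E.-integrable setT (EFin \o (f \o rV_cons)).
  apply/integrableP; split; first by apply/measurable_EFinP; exact: measurableT_comp.
  move: fi => /integrableP[_]; apply: le_lt_trans.
  rewrite [leRHS](_ : _ = \int[pushforward (@lebesgue_measure R \x leb n)%E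
    (@rV_cons R n)]_x `|(f x)%:E|)%E//.
  rewrite ge0_integral_pushforward//.
  by apply: measurableT_comp => //; exact/measurable_EFinP.
split=> //.
transitivity (\int[pushforward (@lebesgue_measure R \x leb n)%E (@rV_cons R n)]_x (f x)%:E)%E => //.
by rewrite integral_pushforward//; exact/measurable_EFinP.
Qed.

Lemma integral_deriv_eq0 (g g' : R -> R) M : continuous g' ->
  (forall t : R, is_derive t 1 g (g' t)) ->
  (forall t, M < `|t| -> g t = 0) -> (forall t, M < `|t| -> g' t = 0) ->
  (\int[@lebesgue_measure R]_t (g' t)%:E = 0)%E.
Proof.
(* The absolute value is there because M may be negative, and the added 1 makes g vanish at both
   endpoints of [-N, N]. *)
move=> cg' dg g0 g'0; pose N := `|M| + 1.
have N0 : 0 < N by rewrite ltr_pwDr.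
have MN : M < N by rewrite (le_lt_trans (ler_norm M))// ltrDl.
have cg : continuous g.
  by move=> t; apply: differentiable_continuous; apply/derivable1_diffP; exact: ex_derive.
rewrite (_ : (fun t => (g' t)%:E) = (fun t => (g' t)%:E) \_ `[- N, N]%classic); last first.
  apply/funext => t; rewrite /patch; case: ifPn => //; rewrite notin_setE /= in_itv/= -ler_norml.
  by move=> /negP; rewrite -ltNge => Nt; rewrite g'0// (lt_trans MN).
rewrite -integral_mkcond.
rewrite (@continuous_FTC2 _ g' g)//.
- by rewrite !g0 ?subee// ?normrN gtr0_norm.
- by rewrite -subr_gt0 opprK addr_gt0.
- exact: continuous_subspaceT.
- split; first by move=> t _; exact: ex_derive.
    by apply: cvg_at_right_filter; exact: cg.
  by apply: cvg_at_left_filter; exact: cg.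
- by move=> t _; rewrite derive1E derive_val.
Qed.

(** Fubini along [rV_cons]. A derivative in the first coordinate is integrated in that coordinate
    first and vanishes by the fundamental theorem of calculus; a derivative in another coordinate is
    a partial derivative of each slice, to which the induction hypothesis applies. *)
Lemma integral_partial_eq0 n (i : 'I_n) (f : 'rV[R]_n -> R) M :
  continuous (partial i f) -> (forall x, derivable f x (delta_mx ord0 i)) ->
  (forall x, ~ box M x -> f x = 0) ->
  (\int[leb n]_x (partial i f x)%:E = 0)%E.
Proof.
elim: n i f => [[]//|n ih] i f cpf df f0.
have pf0 := partial_off_box i f0.
have [fci ->] := integral_leb_cons (continuous_box_integrable cpf pf0).
case: (unliftP ord0 i) => [j ij|i0].
- rewrite -(integral12_prod_meas1 fci) /fubini_F.
  apply: integral0_eq => t _ /=.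
  pose h (y : 'rV[R]_n) := f (rV_cons (t, y)).
  (* The difference quotients agree as functions of the increment, so derivability and the value of
     the derivative are transported together. *)
  have qE y : (fun s : R => s^-1 *: ((h \o shift y) (s *: delta_mx ord0 j) - h y)) =
      (fun s : R => s^-1 *: ((f \o shift (rV_cons (t, y))) (s *: delta_mx ord0 i) -
        f (rV_cons (t, y)))).
    by apply/funext => s; rewrite /h /= ij rV_cons_shiftS.
  have pE : (fun y => partial i f (rV_cons (t, y))) = partial j h.
    by apply/funext => y; rewrite /partial /derive qE.
  have pE' y := congr1 (fun k => k y) pE.
  under eq_integral do rewrite pE'.
  apply: ih.
  + rewrite -pE => y; apply: (@continuous_comp _ _ _ (fun y => rV_cons (t, y))).
      exact: rV_cons_continuousr.
    exact: cpf.
  + by move=> y; rewrite /derivable qE; exact: df.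
  + move=> y ny; apply: f0 => bx; apply: ny => k.
    by have := bx (lift ord0 k); rewrite rV_consS.
- rewrite -(integral21_prod_meas1 fci) /fubini_G.
  apply: integral0_eq => y _ /=.
  have offb (t : R) : M < `|t| -> ~ box M (rV_cons (t, y)).
    by move=> Mt /(_ ord0); rewrite rV_cons0 leNgt Mt.
  apply: (@integral_deriv_eq0 (fun t => f (rV_cons (t, y)))
    (fun t => partial i f (rV_cons (t, y))) M).
  + move=> t; apply: (@continuous_comp _ _ _ (fun t => rV_cons (t, y))).
      exact: rV_cons_continuousl.
    exact: cpf.
  + move=> t; have qE :
      (fun s : R => s^-1 *: (((fun t => f (rV_cons (t, y))) \o shift t) (s *: 1) -
        f (rV_cons (t, y)))) =
      (fun s : R => s^-1 *: ((f \o shift (rV_cons (t, y))) (s *: delta_mx ord0 i) -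
        f (rV_cons (t, y)))).
      by apply/funext => s /=; rewrite i0 rV_cons_shift0 [_%:A]mulr1.
    by split; [rewrite /derivable qE; exact: df|rewrite /partial /derive qE].
  + by move=> t /offb /f0.
  + by move=> t /offb /pf0.
Qed.

(* The integrand p d_i^2 phi + a^2 p phi is the i-th derivative of
   p d_i phi - a q phi. *)
Lemma integral_wave_partial2 n (i : 'I_n) (p q phi : 'rV[R]_n -> R) (a M : R) :
  continuous p ->
  (forall x, is_derive x (delta_mx ord0 i : 'rV[R]_n) p (a * q x)) ->
  (forall x, is_derive x (delta_mx ord0 i : 'rV[R]_n) q (- (a * p x))) ->
  continuous phi -> (forall x, derivable phi x (delta_mx ord0 i)) ->
  continuous (partial i (partial i phi)) ->
  (forall x, derivable (partial i phi) x (delta_mx ord0 i)) ->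
  (forall x, ~ box M x -> phi x = 0) ->
  \int[leb n]_x (p x * partial i (partial i phi) x) =
  - (a ^+ 2 * \int[leb n]_x (p x * phi x)).
Proof.
move=> cp dp dq cphi dphi cd2 dd1 phi0.
pose psi := p * partial i phi - a *: (q * phi).
have dpsi x : is_derive x (delta_mx ord0 i : 'rV[R]_n) psi
    (p x * partial i (partial i phi) x + a ^+ 2 * (p x * phi x)).
  have d1 := derivableP (dphi x); have d2 := derivableP (dd1 x).
  have dpx := dp x; have dqx := dq x.
  rewrite -/(partial i phi x) in d1; rewrite -/(partial i (partial i phi) x) in d2.
  apply: is_derive_eq; rewrite /GRing.scale /=; ring.
have pE : partial i psi = (fun x => p x * partial i (partial i phi) x + a ^+ 2 * (p x * phi x)).
  by apply/funext => x; rewrite /partial derive_val.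
have d2phi0 := partial_off_box i (partial_off_box i phi0).
have ipd2 : (leb n).-integrable setT (EFin \o (fun x => p x * partial i (partial i phi) x)).
  apply: (@continuous_box_integrable _ _ _ M); first exact: continuous_funM.
  by move=> x /d2phi0 ->; rewrite mulr0.
have ipphi : (leb n).-integrable setT (EFin \o (fun x => p x * phi x)).
  apply: (@continuous_box_integrable _ _ _ M); first exact: continuous_funM.
  by move=> x /phi0 ->; rewrite mulr0.
have : \int[leb n]_x (p x * partial i (partial i phi) x + a ^+ 2 * (p x * phi x)) = 0.
  rewrite -pE /Rintegral (@integral_partial_eq0 _ _ _ M)//.
  - have cc : continuous (fun _ : 'rV[R]_n => a ^+ 2) by exact: cst_continuous.
    rewrite pE; apply: continuous_funD (continuous_funM cp cd2) _.
    exact: continuous_funM cc (continuous_funM cp cphi).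
  - move=> x nx; rewrite /psi /= !fctE (partial_off_box i phi0 nx) phi0// !mulr0.
    by rewrite scaler0 subrr.
rewrite RintegralD//; last first.
  by have := integrableZl measurableT (a ^+ 2) ipphi.
by rewrite RintegralZl// => /eqP; rewrite addr_eq0 => /eqP.
Qed.

End partial_derivatives.

(** * The Fourier integral of the Laplacian of a test function *)

Section fourier_laplacian.
Context {R : realType} {n : nat}.
Local Notation T := 'rV[R]_n.
Implicit Types (xi x : T) (phi p q f : T -> R) (u v w g h : T -> R[i]).

Definition sqenorm xi : R := dot xi xi.

Lemma sqenorm_ge0 xi : 0 <= sqenorm xi.
Proof. by apply: sumr_ge0 => i _; rewrite -expr2 sqr_ge0. Qed.

Lemma measurable_sqenorm : measurable_fun setT (sqenorm : T -> R).
Proof.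
apply: measurable_sum => i; apply: measurable_funM; exact: measurable_rV_coord.
Qed.

Lemma dot_line xi i (t : R) x :
  dot xi (t *: delta_mx ord0 i + x) = t * xi ord0 i + dot xi x.
Proof.
rewrite /dot (eq_bigr (fun j => t * (xi ord0 j * (i == j)%:R) + xi ord0 j * x ord0 j)).
  rewrite big_split/= -mulr_sumr (bigD1 i)//= eqxx mulr1 big1 ?addr0// => j ji.
  by rewrite eq_sym (negbTE ji) mulr0.
by move=> j _; rewrite !mxE eqxx /= eq_sym; ring.
Qed.

Lemma continuous_dot xi : continuous (dot xi).
Proof.
rewrite (_ : dot xi = fun x => \sum_(i < n) xi ord0 i * x ord0 i)//.
elim: (index_enum _) => [|i s ih].
  by under eq_fun do rewrite big_nil; exact: cst_continuous.
under eq_fun do rewrite big_cons.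
apply: continuous_funD ih; apply: continuous_funM; first exact: cst_continuous.
exact: coord_continuous.
Qed.

(** Real part of the plane wave e^(-i xi.x). With the sine below, it forms the pair (p, q) of
    [integral_wave_partial2], for a = xi_i. *)
Lemma is_derive_cos_wave xi i x : is_derive x (delta_mx ord0 i : T)
  (fun x => cos (- dot xi x)) (xi ord0 i * sin (- dot xi x)).
Proof.
apply: is_derive_line.
rewrite (_ : (fun _ => _) = cos \o (fun t : R => - (t * xi ord0 i + dot xi x))); last first.
  by apply/funext => t /=; rewrite dot_line.
have dl : is_derive (0 : R) 1 (fun t : R => - (t * xi ord0 i + dot xi x)) (- xi ord0 i).
  rewrite (_ : (fun _ => _) = - (xi ord0 i *: id + cst (dot xi x))); last first.
    by apply/funext => t; rewrite !fctE /= /GRing.scale/= mulrC.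
  by apply: is_derive_eq; rewrite addr0 [_%:A]mulr1.
apply: is_derive_eq; rewrite mul0r add0r; ring.
Qed.

Lemma is_derive_sin_wave xi i x : is_derive x (delta_mx ord0 i : T)
  (fun x => sin (- dot xi x)) (- (xi ord0 i * cos (- dot xi x))).
Proof.
apply: is_derive_line.
rewrite (_ : (fun _ => _) = sin \o (fun t : R => - (t * xi ord0 i + dot xi x))); last first.
  by apply/funext => t /=; rewrite dot_line.
have dl : is_derive (0 : R) 1 (fun t : R => - (t * xi ord0 i + dot xi x)) (- xi ord0 i).
  rewrite (_ : (fun _ => _) = - (xi ord0 i *: id + cst (dot xi x))); last first.
    by apply/funext => t; rewrite !fctE /= /GRing.scale/= mulrC.
  by apply: is_derive_eq; rewrite addr0 [_%:A]mulr1.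
apply: is_derive_eq; rewrite mul0r add0r; ring.
Qed.

Lemma continuous_cos_wave xi : continuous (fun x => cos (- dot xi x)).
Proof.
move=> x; apply: (@continuous_comp _ _ _ (fun x => - dot xi x) cos).
  by apply: continuousN; exact: continuous_dot.
exact: continuous_cos.
Qed.

Lemma continuous_sin_wave xi : continuous (fun x => sin (- dot xi x)).
Proof.
move=> x; apply: (@continuous_comp _ _ _ (fun x => - dot xi x) sin).
  by apply: continuousN; exact: continuous_dot.
exact: continuous_sin.
Qed.

Lemma L1_real_box f M : continuous f -> (forall x, ~ box M x -> f x = 0) ->
  L1 (fun x => (f x)%:C).
Proof.
move=> cf f0; have mf := continuous_measurable_rV cf.
split; first exact: cmeasurable_real.
have /integrableP[_] := continuous_box_integrable cf f0.
by congr (_ < _)%E; apply: eq_integral => x _; rewrite normc_real.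
Qed.

Lemma L2_real_box f M : continuous f -> (forall x, ~ box M x -> f x = 0) ->
  L2 (fun x => (f x)%:C).
Proof.
move=> cf f0; have mf := continuous_measurable_rV cf.
apply/L2P; split => /=; last first.
  by split => //; under eq_fun do rewrite expr0n/=; exact: integrable0.
split => //; apply: (@continuous_box_integrable _ _ (fun x => f x ^+ 2) M).
  by under eq_fun do rewrite expr2; exact: continuous_funM.
by move=> x /f0 ->; rewrite expr0n.
Qed.

Lemma Rintegral_sum (s : seq 'I_n) (f : 'I_n -> T -> R) :
  (forall i, (leb n).-integrable setT (EFin \o f i)) ->
  \int[leb n]_x (\sum_(i <- s) f i x) = \sum_(i <- s) \int[leb n]_x f i x /\
  (leb n).-integrable setT (EFin \o (fun x => \sum_(i <- s) f i x)).
Proof.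
move=> fi; elim: s => [|i s [ih1 ih2]].
  split; last by under eq_fun do rewrite big_nil; exact: integrable0.
  by rewrite big_nil; under eq_Rintegral do rewrite big_nil; rewrite /Rintegral integral0.
have E : EFin \o (fun x => \sum_(j <- i :: s) f j x) =
    ((EFin \o f i) \+ (EFin \o (fun x => \sum_(j <- s) f j x)%R))%E.
  by apply/funext => x /=; rewrite big_cons EFinD.
split; last by rewrite E; exact: integrableD.
by rewrite big_cons -ih1 -RintegralD//; apply: eq_Rintegral => x _; rewrite big_cons.
Qed.

Section test_function.
Variables (phi : T -> R) (M : R).
Hypothesis sphi : smooth phi.
Hypothesis phi0 : forall x, ~ box M x -> phi x = 0.

Let cphi : continuous phi. Proof. exact: (sphi [::]).1. Qed.
Let cd2 i : continuous (partial i (partial i phi)).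
Proof. exact: (sphi [:: i; i]).1. Qed.
Let d2phi0 i := partial_off_box i (partial_off_box i phi0).

Lemma laplacian_off_box x : ~ box M x -> laplacian phi x = 0.
Proof. by move=> nx; apply: big1 => i _; exact: d2phi0. Qed.

Lemma continuous_laplacian : continuous (laplacian phi).
Proof.
rewrite (_ : laplacian phi = fun x => \sum_(i < n) partial i (partial i phi) x)//.
elim: (index_enum _) => [|i s ih].
  by under eq_fun do rewrite big_nil; exact: cst_continuous.
under eq_fun do rewrite big_cons.
by apply: continuous_funD; [exact: cd2|exact: ih].
Qed.

(** Summation over i; p is left abstract so as to cover both the cosine and the sine. *)
Lemma integral_wave_laplacian xi p : continuous p ->
  (forall i, \int[leb n]_x (p x * partial i (partial i phi) x) =
    - (xi ord0 i ^+ 2 * \int[leb n]_x (p x * phi x))) ->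
  \int[leb n]_x (p x * - laplacian phi x) = sqenorm xi * \int[leb n]_x (p x * phi x).
Proof.
move=> cp h.
have ip i : (leb n).-integrable setT (EFin \o (fun x => p x * partial i (partial i phi) x)).
  apply: (@continuous_box_integrable _ _ _ M).
    by apply: continuous_funM; [exact: cp|exact: cd2].
  by move=> x /d2phi0 ->; rewrite mulr0.
have [E Ei] := Rintegral_sum (index_enum 'I_n) ip.
transitivity (- \int[leb n]_x (\sum_(i < n) p x * partial i (partial i phi) x)).
  rewrite -mulN1r -RintegralZl//; apply: eq_Rintegral => x _.
  by rewrite mulN1r mulrN /laplacian mulr_sumr.
rewrite E -sumrN /sqenorm /dot mulr_suml; apply: eq_bigr => i _.
by rewrite h opprK expr2.
Qed.

Lemma fourier_integral_laplacian xi :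
  fourier_integral (fun x => (- laplacian phi x)%:C) xi =
  (sqenorm xi)%:C * fourier_integral (fun x => (phi x)%:C) xi.
Proof.
rewrite /fourier_integral mulrCA; congr (_ * _).
have dphi i x : derivable phi x (delta_mx ord0 i) := (sphi [::]).2 i x.
have dd1 i x : derivable (partial i phi) x (delta_mx ord0 i) := (sphi [:: i]).2 i x.
have hc := integral_wave_laplacian (@continuous_cos_wave xi) (fun i =>
  integral_wave_partial2 (@continuous_cos_wave xi) (is_derive_cos_wave xi i)
   (is_derive_sin_wave xi i) cphi (dphi i) (@cd2 i) (dd1 i) phi0).
(* For the imaginary part, sine and cosine exchange roles, which turns a into -xi_i; only a^2 enters
   the result. *)
have dsc i x : is_derive x (delta_mx ord0 i : T) (fun x => sin (- dot xi x))
    (- xi ord0 i * cos (- dot xi x)).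
  by rewrite mulNr; exact: is_derive_sin_wave.
have dcs i x : is_derive x (delta_mx ord0 i : T) (fun x => cos (- dot xi x))
    (- (- xi ord0 i * sin (- dot xi x))).
  by rewrite mulNr opprK; exact: is_derive_cos_wave.
have hs := integral_wave_laplacian (xi := xi) (@continuous_sin_wave xi) (fun i =>
  etrans (integral_wave_partial2 (@continuous_sin_wave xi) (dsc i)
   (dcs i) cphi (dphi i) (@cd2 i) (dd1 i) phi0)
   (congr1 (fun c => - (c * _)) (sqrrN (xi ord0 i)))).
apply: complexP; rewrite ?cReM ?cImM /=.
- rewrite mul0r subr0.
  transitivity (\int[leb n]_x (cos (- dot xi x) * - laplacian phi x)).
    by apply: eq_Rintegral => x _; rewrite mulr0 subr0.
  rewrite hc; congr (_ * _).
  by apply: eq_Rintegral => x _; rewrite mulr0 subr0.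
- rewrite mul0r addr0.
  transitivity (\int[leb n]_x (sin (- dot xi x) * - laplacian phi x)).
    by apply: eq_Rintegral => x _; rewrite mulr0 add0r.
  rewrite hs; congr (_ * _).
  by apply: eq_Rintegral => x _; rewrite mulr0 add0r.
Qed.

End test_function.

Lemma test_function_box phi : test_function phi ->
  exists M, forall x, ~ box M x -> phi x = 0.
Proof.
move=> [_ [K cK phi0]]; have [M [Mr KM]] := compact_bounded cK.
exists (M + 1) => x nx; apply: phi0 => Kx; apply: nx => i.
apply: le_trans (coord_le_norm _ _) _.
by apply: (KM (M + 1)) => //; rewrite ltrDl.
Qed.

End fourier_laplacian.

(** * The spectral resolution in the Fourier picture *)

Section L2_operators.
Context {R : realType} {n : nat}.
Local Notation T := 'rV[R]_n.
Implicit Types (u v w g h : T -> R[i]).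

Lemma L2_ae u v : cmeasurable u -> L2 v -> ae_equal u v -> L2 u.
Proof.
move=> mu Lv uv; split=> //=.
by rewrite -/(sqnorm u) (sqnorm_ae mu _ uv); [case: Lv|case: Lv].
Qed.

Lemma linear_on_L2_0 (F : (T -> R[i]) -> T -> R[i]) : linear_on_L2 F ->
  ae_equal (F (fun=> 0)) (fun=> 0).
Proof.
move=> lF; have := lin_lin lF (-1) (@L2_0 R n) (@L2_0 R n).
rewrite (_ : (fun x => -1 * 0 + 0) = (fun=> 0)); last first.
  by apply/funext => x; rewrite mulr0 addr0.
by apply: filterS => x ->; rewrite mulN1r addNr.
Qed.

Lemma linear_on_L2B (F : (T -> R[i]) -> T -> R[i]) u v : linear_on_L2 F ->
  L2 u -> L2 v -> ae_equal (F (fun x => u x - v x)) (fun x => F u x - F v x).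
Proof.
move=> lF Lu Lv; have := lin_lin lF (-1) Lv Lu.
rewrite (_ : (fun x => -1 * v x + u x) = (fun x => u x - v x)); last first.
  by apply/funext => x; rewrite mulN1r addrC.
by apply: filterS => x ->; rewrite mulN1r addrC.
Qed.

Lemma linear_on_L2_sum (F : (T -> R[i]) -> T -> R[i]) (w : nat -> T -> R[i]) N :
  linear_on_L2 F -> (forall k, L2 (w k)) ->
  ae_equal (F (fun x => \sum_(k < N) w k x)) (fun x => \sum_(k < N) F (w k) x).
Proof.
move=> lF Lw; elim: N => [|N ih].
  rewrite (_ : (fun x => \sum_(k < 0) w k x) = (fun=> 0)); last first.
    by apply/funext => x; rewrite big_ord0.
  by apply: filterS (linear_on_L2_0 lF) => x ->; rewrite big_ord0.
rewrite (_ : (fun x => \sum_(k < N.+1) w k x) =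
    (fun x => 1 * w N x + \sum_(k < N) w k x)); last first.
  by apply/funext => x; rewrite big_ord_recr/= mul1r addrC.
apply: filterS2 (lin_lin lF 1 (Lw N) (L2_sum N Lw)) ih => x -> ->.
by rewrite mul1r big_ord_recr/= addrC.
Qed.

Lemma linear_on_L2_comp (F G : (T -> R[i]) -> T -> R[i]) :
  linear_on_L2 F -> linear_on_L2 G -> linear_on_L2 (F \o G).
Proof.
move=> lF lG; split => [u Lu|u v Lu Lv uv|a u v Lu Lv] /=.
- by apply: (lin_L2 lF); exact: (lin_L2 lG).
- by apply: (lin_ae lF); [exact: (lin_L2 lG)|exact: (lin_L2 lG)|exact: (lin_ae lG)].
- have LGu := lin_L2 lG Lu; have LGv := lin_L2 lG Lv.
  apply: ae_equal_trans (lin_lin lF a LGu LGv).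
  apply: (lin_ae lF); [exact/(lin_L2 lG)/L2_lin|exact: L2_lin|exact: (lin_lin lG)].
Qed.

End L2_operators.

Section fourier_picture.
Context {R : realType} {n : nat}.
Local Notation T := 'rV[R]_n.
Local Notation set := (set (measurableTypeR R)).
Implicit Types (u v w g h : T -> R[i]) (A B : set).
Variables F Finv : (T -> R[i]) -> T -> R[i].
Hypothesis hF : unitary_fourier F Finv.

Lemma fourier_L2 u : L2 u -> L2 (F u). Proof. exact: (lin_L2 (fourier_linear hF)). Qed.
Lemma fourier_inv_L2 u : L2 u -> L2 (Finv u). Proof. exact: (lin_L2 (fourier_inv_linear hF)). Qed.

Lemma inner_fourier_inv g v : L2 g -> L2 v -> inner g (F v) = inner (Finv g) v.
Proof.
move=> Lg Lv; have Lig := fourier_inv_L2 Lg.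
rewrite -(fourier_inner hF Lig Lv); apply: inner_ae_L2 => //; try exact: fourier_L2.
by apply: ae_equal_sym; exact: (fourierVK hF).
Qed.

(** By unitarity <u, -Delta phi> = <F u, |xi|^2 F phi> = <|xi|^2 F u, F phi>, and F moves back to
    the other side. The integral formula for F is applied only to phi and Delta phi, which are
    continuous with bounded support and so lie in both L^1 and L^2. *)
Lemma neg_laplacian_fourier u : L2 u -> L2 (rmul sqenorm (F u)) ->
  neg_laplacian u (Finv (rmul sqenorm (F u))).
Proof.
move=> Lu Lr; have Lf := fourier_inv_L2 Lr; split=> // phi tphi.
have [M phi0] := test_function_box tphi; have [sphi _] := tphi.
have cphi : continuous phi := (sphi [::]).1.
have L0 x : ~ box M x -> - laplacian phi x = 0.
  by move=> /(laplacian_off_box phi0) ->; rewrite oppr0.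
have cL : continuous (fun x => - laplacian phi x).
  by move=> x; apply: continuousN; exact: continuous_laplacian.
have L1p := L1_real_box cphi phi0; have L2p := L2_real_box cphi phi0.
have L1l := L1_real_box cL L0; have L2l := L2_real_box cL L0.
(* Test functions are real, so the conjugation in [inner] leaves them unchanged. *)
have cE w (f : T -> R) : cintegral (fun x => w x * (f x)%:C) = inner w (fun x => (f x)%:C).
  rewrite /inner; congr cintegral; apply/funext => x; congr (_ * _).
  by apply: complexP; rewrite ?cReJ ?cImJ//= oppr0.
have Fl : ae_equal (F (fun x => (- laplacian phi x)%:C)) (rmul sqenorm (F (fun x => (phi x)%:C))).
  apply: filterS2 (fourierE hF L1l L2l) (fourierE hF L1p L2p) => x -> E.
  by rewrite /rmul E; exact: (fourier_integral_laplacian sphi phi0).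
have LFl := fourier_L2 L2l; have LFp := fourier_L2 L2p; have LFu := fourier_L2 Lu.
rewrite !cE -(fourier_inner hF Lu L2l) -inner_fourier_inv// inner_rmul.
apply: inner_ae => //; try exact: L2_cmeasurable.
by apply: cmeasurable_rmul; [exact: measurable_sqenorm|exact: L2_cmeasurable].
Qed.

Definition fourier_conj (E : classical_sets.set R -> (T -> R[i]) -> T -> R[i])
  (B : classical_sets.set R) := F \o (E B \o Finv).

Lemma sqnorm_fourier u : L2 u -> sqnorm (F u) = sqnorm u.
Proof.
by move=> Lu; rewrite !sqnormE// ?/nrm2 ?(fourier_inner hF)//; exact: fourier_L2.
Qed.

Lemma spectral_measure_fourier_conj E : spectral_measure E ->
  spectral_measure (fourier_conj E).
Proof.
move=> hE; rewrite /fourier_conj; split.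
- move=> B mB BH; apply: linear_on_L2_comp (fourier_linear hF) _.
  exact: linear_on_L2_comp (spec_linear hE mB BH) (fourier_inv_linear hF).
- move=> B g h mB BH Lg Lh /=; have sB : spec_set B by [].
  have Lig := fourier_inv_L2 Lg; have Lih := fourier_inv_L2 Lh.
  have LEg := spec_L2 hE sB Lig; have LEh := spec_L2 hE sB Lih.
  (* [inner_fourier_inv] takes F off the second argument only; conjugate symmetry brings the other
     occurrence there and back. *)
  rewrite inner_fourier_inv// innerJ ?inner_fourier_inv -?innerJ//; try exact: fourier_L2.
  by rewrite (spec_sym hE).
- move=> A B g mA AH mB BH Lg /=.
  have sA : spec_set A by []; have sB : spec_set B by [].
  have Lig := fourier_inv_L2 Lg; have LB := spec_L2 hE sB Lig.
  have LFB := fourier_L2 LB; have LiFB := fourier_inv_L2 LFB.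
  have h1 : ae_equal (E (A `&` B) (Finv g)) (E A (Finv (F (E B (Finv g))))).
    apply: ae_equal_trans (spec_setI hE mA AH mB BH Lig) _.
    by apply: (spec_ae hE sA) => //; apply: ae_equal_sym; exact: (fourierK hF).
  apply: (lin_ae (fourier_linear hF)) h1; apply: (spec_L2 hE) => //.
  exact: spec_setIl sA mB.
- move=> g Lg /=; have Lig := fourier_inv_L2 Lg.
  have LH := spec_L2 hE spec_set_setT Lig.
  apply: ae_equal_trans (fourierVK hF Lg).
  apply: (lin_ae (fourier_linear hF)) => //; exact: (spec_setT hE).
- move=> B g mB BH tB Lg /=; have Lig := fourier_inv_L2 Lg.
  have sB k : spec_set (B k) by [].
  have sU : spec_set (\bigcup_k B k).
    by split; [exact: bigcupT_measurable|apply: bigcup_sub].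
  have := spec_additive hE mB BH tB Lig.
  have LB k := spec_L2 hE (sB k) Lig; have LU := spec_L2 hE sU Lig.
  apply: cvg_trans; apply: near_eq_cvg; apply: nearW => N.
  have LS := L2_sum N LB.
  have LFS := L2_sum N (fun k => fourier_L2 (LB k)).
  rewrite -sqnorm_fourier; last exact: L2B.
  apply: sqnorm_ae.
  + by apply: L2_cmeasurable; apply: fourier_L2; exact: L2B.
  + by apply: L2_cmeasurable; apply: L2B => //; exact: fourier_L2.
  apply: ae_equal_trans (linear_on_L2B (fourier_linear hF) LU LS) _.
  by apply: filterS (linear_on_L2_sum N (fourier_linear hF) LB) => x ->.
Qed.

Variable E : classical_sets.set R -> (T -> R[i]) -> T -> R[i].
Hypothesis hE : spectral_resolution E.

Let hE' : spectral_measure E := hE.1.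

Lemma has_cintegral_ext nu nu' D (f : R -> R) (z : R[i]) :
  (forall B : set, measurable B -> nu B = nu' B) ->
  has_cintegral nu D f z -> has_cintegral nu' D f z.
Proof.
move=> nn' [a [b [c [d [nuE h1 h2 h3]]]]]; exists a, b, c, d; split => // B mB.
by rewrite -nn'// nuE.
Qed.

(** The resolution is read at u = F^-1 g, whose Laplacian is supplied by [neg_laplacian_fourier],
    and unitarity carries the weak integral to the Fourier side. This is the hypothesis [Grho] for
    rho = |xi|^2. *)
Lemma fourier_conj_resolution g h : L2 g -> L2 (rmul sqenorm g) -> L2 h ->
  has_cintegral (spec_form (fourier_conj E) g h) halfline id (inner (rmul sqenorm g) h).
Proof.
move=> Lg Lr Lh; have Lu := fourier_inv_L2 Lg; have Lv := fourier_inv_L2 Lh.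
have LFu := fourier_L2 Lu; have Fug := fourierVK hF Lg.
have rFu := ae_equal_rmul sqenorm Fug.
have Lr' : L2 (rmul sqenorm (F (Finv g))).
  apply: L2_ae Lr rFu; apply: cmeasurable_rmul; first exact: measurable_sqenorm.
  exact: L2_cmeasurable.
have [_ [_ _ hi]] := (hE.2 _ _).1 (neg_laplacian_fourier Lu Lr').
have := hi _ Lv; rewrite -inner_fourier_inv//.
have -> : inner (rmul sqenorm (F (Finv g))) (F (Finv h)) = inner (rmul sqenorm g) h.
  by apply: inner_ae_L2 => //; [exact: fourier_L2|exact: (fourierVK hF)].
apply: has_cintegral_ext => B mB.
have sB := spec_set_halfline mB; have LB := spec_L2 hE' sB Lu.
rewrite /spec_form /fourier_conj /= -(fourier_inner hF LB Lv).
by apply: inner_ae_L2 => //; try exact: fourier_L2; exact: (fourierVK hF).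
Qed.

Lemma fourier_spec B u : measurable B -> L2 u ->
  ae_equal (F (E (B `&` halfline) u)) (rmul (fun x => \1_B (sqenorm x)) (F u)).
Proof.
move=> mB Lu; have LFu := fourier_L2 Lu; have sB := spec_set_halfline mB.
have := spec_eq_indicator (spectral_measure_fourier_conj hE') measurable_sqenorm
  sqenorm_ge0 fourier_conj_resolution mB LFu.
apply: ae_equal_trans.
have LiFu := fourier_inv_L2 LFu.
apply: (lin_ae (fourier_linear hF)); [exact: (spec_L2 hE')|exact: (spec_L2 hE')|].
by apply: (spec_ae hE') => //; apply: ae_equal_sym; exact: (fourierK hF).
Qed.

Lemma spec_form_fourier B u v : measurable B -> L2 u -> L2 v ->
  spec_form E u v B = inner (rmul (fun x => \1_B (sqenorm x)) (F u)) (F v).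
Proof.
move=> mB Lu Lv; have sB := spec_set_halfline mB.
have LB := spec_L2 hE' sB Lu.
rewrite /spec_form -(fourier_inner hF LB Lv).
apply: inner_ae => //; try exact/L2_cmeasurable/fourier_L2.
  apply: cmeasurable_rmul; last exact/L2_cmeasurable/fourier_L2.
  by apply: measurableT_comp measurable_sqenorm; exact: measurable_indic.
exact: fourier_spec.
Qed.

End fourier_picture.

(** * Change of variables *)

Section density_pushforward.
Context d1 d2 (X : measurableType d1) (Y : measurableType d2) (R : realType).
Variable mu : {measure set X -> \bar R}.
Variables (phi : X -> Y) (k : X -> R).
Hypothesis mphi : measurable_fun setT phi.
Hypothesis k_ge0 : forall x, 0 <= k x.
Hypothesis ik : mu.-integrable setT (EFin \o k).
Local Open Scope ereal_scope.

(* The hypotheses are arguments so that the measure structures below can be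
   inferred from the term. *)
Definition density_pushforward of measurable_fun setT phi & (forall x, 0 <= k x)%R &
    mu.-integrable setT (EFin \o k) : set Y -> \bar R :=
  fun B => \int[mu]_(x in phi @^-1` B) (k x)%:E.

Local Notation nu := (density_pushforward mphi k_ge0 ik).

Let mpre (B : set Y) : measurable B -> measurable (phi @^-1` B).
Proof. by move=> mB; rewrite -[X in measurable X]setTI; exact: mphi. Qed.

Let mk : measurable_fun setT (EFin \o k). Proof. by case/integrableP : ik. Qed.

Let nu0 : nu set0 = 0.
Proof. by rewrite /density_pushforward preimage_set0 integral_set0. Qed.

Let nu_ge0 B : 0 <= nu B.
Proof. by apply: integral_ge0 => x _; rewrite lee_fin. Qed.

Let nu_sigma_additive : semi_sigma_additive nu.
Proof.
move=> B mB tB mUB; rewrite /density_pushforward preimage_bigcup.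
rewrite ge0_integral_bigcup//=.
- apply: is_cvg_ereal_nneg_natsum_cond => j _ _.
  by apply: integral_ge0 => x _; rewrite lee_fin.
- by move=> j; exact: mpre.
- exact: measurable_funTS mk.
- by move=> x _; rewrite lee_fin.
- apply/trivIsetP => i j _ _ ij; rewrite -preimage_setI.
  by move/trivIsetP : tB => /(_ _ _ I I ij) ->; rewrite preimage_set0.
Qed.

HB.instance Definition _ := isMeasure.Build _ _ _ nu nu0 nu_ge0 nu_sigma_additive.

Let nu_fin : fin_num_fun nu.
Proof.
move=> B mB; rewrite /density_pushforward.
by apply: integrable_fin_num; [exact: mpre|apply: integrableS ik => //; exact: mpre].
Qed.

HB.instance Definition _ := @Measure_isFinite.Build _ _ _ nu nu_fin.

Import HBNNSimple.

Let mem_pre (B : set Y) x : (x \in phi @^-1` B) = (phi x \in B).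
Proof. by apply/idP/idP; rewrite !inE. Qed.

Let nnsfun_integral (h : {nnsfun Y >-> R}) :
  \int[nu]_y (h y)%:E = \int[mu]_x ((h (phi x))%:E * (k x)%:E).
Proof.
rewrite integralT_nnsfun sintegralE.
transitivity (\int[mu]_x \sum_(r \in range h)
    (r%:E * ((\1_(h @^-1` [set r]) (phi x))%:E * (k x)%:E))).
  have mh r : measurable_fun setT (fun x => (\1_(h @^-1` [set r]) (phi x))%:E * (k x)%:E).
    apply: emeasurable_funM => //; apply/measurable_EFinP.
    by apply: measurableT_comp mphi; exact: measurable_indic.
  have h0 r x : 0 <= (\1_(h @^-1` [set r]) (phi x))%:E * (k x)%:E.
    by rewrite mule_ge0 ?lee_fin.
  rewrite ge0_integral_fsum//=.
  - apply: eq_fsbigr => r _; have [r0|r0] := leP 0%R r; last first.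
      rewrite preimage_nnfun0// measure0 mule0; apply/esym/integral0_eq => x _.
      by rewrite indicE in_set0 mul0e mule0.
    rewrite ge0_integralZl//; congr (_ * _).
    rewrite /density_pushforward integral_mkcond; apply: eq_integral => x _.
    rewrite /patch indicE /= mem_pre; case: ifPn => hx; last by rewrite mul0e.
    by rewrite mul1e.
  - by move=> r; exact: measurable_funeM.
  - move=> r x _; have [r0|r0] := leP 0%R r; first by rewrite mule_ge0.
    by rewrite preimage_nnfun0// indicE in_set0 mul0e mule0.
apply: eq_integral => x _.
rewrite [in RHS]fimfunE -fsumEFin// ge0_mule_fsuml.
  by apply: eq_fsbigr => r _; rewrite EFinM muleA.
by move=> r; rewrite EFinM nnfun_muleindic_ge0.
Qed.

Let ge0_integralT (f : Y -> \bar R) :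
  measurable_fun setT f -> (forall y, 0 <= f y) ->
  \int[nu]_y f y = \int[mu]_x (f (phi x) * (k x)%:E).
Proof.
move=> mf f0.
pose h := nnsfun_approx measurableT mf.
have hf y : (h j y)%:E @[j --> \oo] --> f y.
  by apply: (cvg_nnsfun_approx measurableT mf) => // *; exact: f0.
have nd y : {homo (fun j => (h j y)%:E) : m j / (m <= j)%N >-> m <= j}.
  by move=> m j mj; rewrite lee_fin; exact/lefP/nd_nnsfun_approx.
transitivity (limn (fun j => \int[nu]_y (h j y)%:E)).
  rewrite -monotone_convergence//.
  - by apply: eq_integral => y _; apply/esym/cvg_lim.
  - by move=> j; exact/measurable_EFinP.
  - by move=> j y _; rewrite lee_fin.
under eq_fun do rewrite nnsfun_integral.
rewrite -monotone_convergence//.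
- apply: eq_integral => x _; apply/cvg_lim => //.
  by apply: cvgeZr => //; exact: hf.
- move=> j; apply: emeasurable_funM => //; apply/measurable_EFinP.
  exact: measurableT_comp.
- by move=> j x _; rewrite mule_ge0 ?lee_fin.
- by move=> x _ m j mj; rewrite lee_wpmul2r ?lee_fin// -lee_fin; exact: nd.
Qed.

Lemma ge0_integral_density_pushforward (f : Y -> \bar R) D : measurable D ->
  measurable_fun setT f -> (forall y, 0 <= f y) ->
  \int[nu]_(y in D) f y = \int[mu]_(x in phi @^-1` D) (f (phi x) * (k x)%:E).
Proof.
move=> mD mf f0; transitivity (\int[mu]_x ((f \_ D) (phi x) * (k x)%:E)).
  rewrite [LHS]integral_mkcond; apply: ge0_integralT.
    by apply/(measurable_restrictT _ mD).1; exact: measurable_funTS.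
  by move=> y; rewrite /patch; case: ifP.
rewrite [RHS]integral_mkcond; apply: eq_integral => x _; rewrite /patch mem_pre.
by case: ifP => // _; rewrite -[point]/(0%E) mul0e.
Qed.

(** The positive and negative parts of g are both dominated by |g|, so their integrals are finite
    and the nonnegative case can be subtracted. *)
Lemma density_pushforwardE (g : Y -> R) D : measurable D -> measurable_fun setT g ->
  mu.-integrable setT (EFin \o (fun x => g (phi x) * k x)%R) ->
  nu.-integrable D (EFin \o g) /\
  (\int[nu]_(y in D) g y = \int[mu]_(x in phi @^-1` D) (g (phi x) * k x))%R.
Proof.
move=> mD mg igk; have mgE : measurable_fun setT (EFin \o g) by exact/measurable_EFinP.
have mP := mpre mD.
have igkD : mu.-integrable (phi @^-1` D) (EFin \o (fun x => g (phi x) * k x)%R).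
  exact: integrableS igk.
split.
  apply/integrableP; split; first exact: measurable_funTS.
  have -> : \int[nu]_(y in D) `|(EFin \o g) y| =
      \int[mu]_(x in phi @^-1` D) `|(EFin \o (fun x => g (phi x) * k x)%R) x|.
    rewrite ge0_integral_density_pushforward//; last exact: measurableT_comp.
    by apply: eq_integral => x _ /=; rewrite -EFinM normrM (ger0_norm (k_ge0 x)).
  by move/integrableP : igkD => [].
rewrite /Rintegral; congr fine; rewrite integralE.
rewrite !ge0_integral_density_pushforward//;
  [|exact: measurable_funeneg|exact: measurable_funepos].
have ipm (f : Y -> \bar R) : measurable_fun setT f -> (forall y, 0 <= f y <= `|(g y)%:E|) ->
    mu.-integrable (phi @^-1` D) (fun x => f (phi x) * (k x)%:E).
  move=> mf fg; apply: le_integrable igkD => //.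
    apply: measurable_funTS; apply: emeasurable_funM => //; exact: measurableT_comp.
  move=> x _ /=; have /andP[f0 fle] := fg (phi x).
  rewrite abseM gee0_abs// normrM EFinM lee_pmul//.
rewrite -integralB//.
- apply: eq_integral => x _ /=; rewrite EFinM -muleBl//.
    by congr (_ * _); have := funeposneg (EFin \o g) => /(congr1 (fun h => h (phi x))).
- exact: (add_def_funeposneg (EFin \o g) (phi x)).
- apply: (ipm (EFin \o g)^\+); first exact: measurable_funepos.
  by move=> y; rewrite funepos_ge0 funeposE ge_max lee_abs abse_ge0.
- apply: (ipm (EFin \o g)^\-); first exact: measurable_funeneg.
  by move=> y; rewrite funeneg_ge0 funenegE ge_max -[leRHS]abseN lee_abs abse_ge0.
Qed.

End density_pushforward.

(** The two measures are the images under rho of f^+ and f^-. These images may overlap, hence need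
    not form a Jordan decomposition, which [has_cintegral] permits. Since g (rho x) = 0 when rho x
    is outside D, integrating over D on the line matches integrating over the whole of R^n. *)
Lemma posneg_density (R : realType) (n : nat) (rho f : 'rV[R]_n -> R) (g : R -> R)
    (D : set (measurableTypeR R)) :
  measurable_fun setT rho -> measurable D -> measurable_fun setT g ->
  (forall x, ~ D (rho x) -> g (rho x) = 0) ->
  (leb n).-integrable setT (EFin \o f) ->
  (leb n).-integrable setT (EFin \o (fun x => g (rho x) * f x)) ->
  exists a b : {finite_measure set (measurableTypeR R) -> \bar R},
  [/\ forall B : set (measurableTypeR R), measurable B ->
        fine (a B) - fine (b B) = \int[leb n]_x (\1_B (rho x) * f x),
      a.-integrable D (EFin \o g), b.-integrable D (EFin \o g) &
      \int[a]_(x in D) g x - \int[b]_(x in D) g x = \int[leb n]_x (g (rho x) * f x)].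
Proof.
move=> mrho mD mg g0 fi gfi.
have mf : measurable_fun setT f by move/integrableP : fi => [/measurable_EFinP].
have mgr : measurable_fun setT (fun x => g (rho x)) by exact: measurableT_comp.
(* c = 1 gives f^+ and c = -1 gives f^-, so that one argument serves both. *)
pose p (c : R) x := Num.max (c * f x) 0.
have p0 c x : 0 <= p c x by rewrite /p le_max lexx orbT.
have mp c : measurable_fun setT (p c).
  by apply: measurable_maxr => //; exact: measurable_funM.
have ple c x : `|c| = 1 -> `|p c x| <= `|f x|.
  move=> c1; rewrite ger0_norm// /p ge_max normr_ge0 andbT.
  by rewrite (le_trans (ler_norm _))// normrM c1 mul1r.
have pi c : `|c| = 1 -> (leb n).-integrable setT (EFin \o p c).
  move=> c1; apply: le_integrable fi => //; first exact/measurable_EFinP.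
  by move=> x _ /=; rewrite lee_fin ple.
have gpi c : `|c| = 1 -> (leb n).-integrable setT (EFin \o (fun x => g (rho x) * p c x)).
  move=> c1; apply: le_integrable gfi => //.
    by apply/measurable_EFinP; exact: measurable_funM.
  by move=> x _ /=; rewrite lee_fin !normrM ler_wpM2l// ple.
have n1 : `|1 : R| = 1 by rewrite normr1.
have nN1 : `|-1 : R| = 1 by rewrite normrN1.
have pE x : p 1 x - p (-1) x = f x.
  rewrite /p mul1r mulN1r; have [f0|f0] := leP (f x) 0.
    by rewrite max_l ?oppr_ge0// sub0r opprK.
  by rewrite max_r ?oppr_le0 ?ltW// subr0.
pose nu c (c1 : `|c| = 1) : {finite_measure set (measurableTypeR R) -> \bar R} :=
  density_pushforward (Y := measurableTypeR R) mrho (p0 c) (pi c c1).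
exists (nu _ n1), (nu _ nN1).
have nuP c (c1 : `|c| = 1) : (nu c c1).-integrable D (EFin \o g) /\
    \int[nu c c1]_(y in D) g y = \int[leb n]_(x in rho @^-1` D) (g (rho x) * p c x).
  exact: (density_pushforwardE (Y := measurableTypeR R) mrho (p0 c) (pi c c1) mD mg (gpi c c1)).
have [ia Ea] := nuP _ n1; have [ib Eb] := nuP _ nN1.
split=> //.
- move=> B mB; have mpB : measurable (rho @^-1` B).
    by rewrite -[X in measurable X]setTI; exact: (mrho measurableT).
  have iB c : `|c| = 1 -> (leb n).-integrable (rho @^-1` B) (EFin \o p c).
    by move=> c1; apply: integrableS (pi _ c1).
  transitivity (\int[leb n]_(x in rho @^-1` B) p 1 x -
    \int[leb n]_(x in rho @^-1` B) p (-1) x) => //.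
  rewrite -RintegralB ?iB// Rintegral_mkcond; apply: eq_Rintegral => x _.
  rewrite /patch indicE; case: ifPn; rewrite ?notin_setE ?inE /= => Bx.
    by rewrite mem_set// mul1r pE.
  by rewrite memNset// mul0r.
- rewrite Ea Eb.
  have mpD : measurable (rho @^-1` D).
    by rewrite -[X in measurable X]setTI; exact: (mrho measurableT).
  rewrite -RintegralB; last 3 first.
  + exact: mpD.
  + by apply: integrableS (gpi _ n1).
  + by apply: integrableS (gpi _ nN1).
  rewrite Rintegral_mkcond; apply: eq_Rintegral => x _.
  rewrite /patch; case: ifPn; rewrite ?notin_setE ?inE /= => Dx.
    by rewrite -mulrBr pE.
  by rewrite g0// mul0r.
Qed.

(** * The fractional-logarithmic Laplacian as a Fourier multiplier *)

Section fraclog.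
Context {R : realType} {n : nat}.
Variable s : R.
Local Notation T := 'rV[R]_n.
Implicit Types (u v w : T -> R[i]).
Variables F Finv : (T -> R[i]) -> T -> R[i].
Hypothesis hF : unitary_fourier F Finv.
Variable E : set R -> (T -> R[i]) -> T -> R[i].
Hypothesis hE : spectral_resolution E.

(** [symb] is the symbol in the spectral variable, [fsymb] in the frequency; they correspond under x
    = |xi|^2. *)
Let symb (x : R) := x `^ s * ln x.
Let fsymb (xi : T) := enorm xi `^ (2 * s) * ln (enorm xi ^+ 2).

Lemma enorm_sqr (xi : T) : enorm xi ^+ 2 = sqenorm xi.
Proof. by rewrite sqr_sqrtr//; exact: sqenorm_ge0. Qed.

Let fsymE xi : fsymb xi = symb (sqenorm xi).
Proof.
rewrite /fsymb /symb powRrM -[in X in (enorm xi `^ X) `^ s](@natr1 R 1) natr1.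
by rewrite powR_mulrn ?enorm_sqr// sqrtr_ge0.
Qed.

Let fsym2E xi : enorm xi `^ (4 * s) * ln (enorm xi ^+ 2) ^+ 2 = fsymb xi ^+ 2.
Proof.
rewrite exprMn; congr (_ * _); rewrite -powR_mulrn ?powR_ge0// -powRrM.
by congr (_ `^ _); ring.
Qed.

Let sym2E x : 0 <= x -> x `^ (2 * s) * ln x ^+ 2 = symb x ^+ 2.
Proof.
move=> x0; rewrite exprMn; congr (_ * _).
by rewrite mulrC powRrM powR_mulrn ?powR_ge0.
Qed.

Let msym : measurable_fun setT symb.
Proof.
by apply: measurable_funM; [exact: measurable_powR|exact: measurable_ln].
Qed.

Let mfsym : measurable_fun setT fsymb.
Proof.
rewrite (_ : fsymb = symb \o sqenorm); last by apply/funext => xi; exact: fsymE.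
exact: measurableT_comp measurable_sqenorm.
Qed.

(** [ln] is 0 on ]-oo, 0] by convention. Hence the spectral integrals over ]0, +oo[ agree with
    Fourier integrals over all of R^n, the point xi = 0 included. *)
Let sym0 x : ~ `]0%R, +oo[%classic x -> symb x = 0.
Proof.
rewrite /= in_itv/= andbT => /negP; rewrite -leNgt => x0.
by rewrite /symb ln0// mulr0.
Qed.

Let energyE u : L2 u ->
  spec_energy E u `]0%R, +oo[%classic (fun x => x `^ (2 * s) * ln x ^+ 2) =
  sqnorm (rmul fsymb (F u)).
Proof.
move=> Lu; have LFu := fourier_L2 hF Lu.
pose k xi := Normc.normc (F u xi) ^+ 2.
have k0 xi : 0 <= k xi by rewrite sqr_ge0.
have kE xi : k xi = complex.Re (F u xi * (F u xi)^*).
  by rewrite cReM cReJ cImJ mulrN opprK -!expr2 -sqr_normc.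
have ik : (leb n).-integrable setT (EFin \o k).
  have [+ _] := cintegrable_inner LFu LFu.
  by apply: integrable_ext => xi /=; rewrite kE.
have mD : measurable (`]0%R, +oo[%classic : set (measurableTypeR R)) by exact: measurable_itv.
rewrite /spec_energy.
transitivity (\int[density_pushforward (Y := measurableTypeR R) measurable_sqenorm k0 ik]_(x in
    (`]0%R, +oo[%classic : set (measurableTypeR R))) (x `^ (2 * s) * ln x ^+ 2)%:E)%E.
  (* On Borel sets E_{u,u} is the image of |F u|^2 under |xi|^2. Nothing is known of it on other
     sets, so it cannot be replaced by that measure outright. *)
  apply: eq_setfun_integral => B mB _; rewrite (spec_form_fourier hF hE mB Lu Lu).
  have mpB : measurable ((sqenorm : T -> R) @^-1` B).
    by rewrite -[X in measurable X]setTI; exact: measurable_sqenorm.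
  rewrite /density_pushforward -[RHS]fineK; last first.
    by apply: integrable_fin_num => //; apply: integrableS ik.
  congr EFin; rewrite -/(Rintegral _ _ _) Rintegral_mkcond /=.
  apply: eq_Rintegral => xi _; rewrite /patch /rmul indicE -mulrA cReM -kE /=.
  case: ifPn; rewrite ?notin_setE ?inE /= => Bx; first by rewrite mem_set// mul1r mul0r subr0.
  by rewrite memNset// !mul0r subr0.
rewrite ge0_integral_density_pushforward//; last 2 first.
- apply/measurable_EFinP; apply: measurable_funM; first exact: measurable_powR.
  by apply: measurable_funX; exact: measurable_ln.
- by move=> y; rewrite lee_fin mulr_ge0 ?powR_ge0 ?sqr_ge0.
rewrite integral_mkcond; apply: eq_integral => xi _.
rewrite /patch normc_rmul exprMn real_normK ?num_real// fsymE -sym2E ?sqenorm_ge0// -EFinM.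
case: ifPn => //; rewrite notin_setE /= => /sym0 sy0.
by rewrite sym2E ?sqenorm_ge0// sy0 expr0n mul0r.
Qed.

Lemma sqnorm_symbolE u : sqnorm (rmul fsymb (F u)) =
  (\int[leb n]_xi (enorm xi `^ (4 * s) * ln (enorm xi ^+ 2) ^+ 2 *
     Normc.normc (F u xi) ^+ 2)%:E)%E.
Proof.
apply: eq_integral => xi _.
by rewrite normc_rmul exprMn real_normK ?num_real// fsym2E.
Qed.

Lemma H_fraclogE : H_fraclog E s =
  [set u | L2 u /\
    (\int[leb n]_xi (enorm xi `^ (4 * s) * ln (enorm xi ^+ 2) ^+ 2 *
       Normc.normc (F u xi) ^+ 2)%:E < +oo)%E].
Proof.
apply/seteqP; split => u /= [Lu].
  by rewrite energyE// sqnorm_symbolE.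
by move=> h; split => //; rewrite energyE// sqnorm_symbolE.
Qed.

Lemma H_fraclog_L2 u : H_fraclog E s u -> L2 (rmul fsymb (F u)).
Proof.
move=> [Lu]; rewrite energyE// => fin; split => //.
by apply: cmeasurable_rmul => //; exact/L2_cmeasurable/(fourier_L2 hF).
Qed.

(** F u and its product with the symbol are both in L^2, so each is integrable against the conjugate
    of F v. [posneg_density], applied to the real and imaginary parts of F u times that conjugate,
    provides the four measures that [has_cintegral] asks for. *)
Lemma fraclog_Finv u : H_fraclog E s u -> fraclog E s u (Finv (rmul fsymb (F u))).
Proof.
move=> Hu; have Lw := H_fraclog_L2 Hu; have [Lu _] := Hu.
have LFu := fourier_L2 hF Lu; split=> //; split=> //; first exact: (fourier_inv_L2 hF).
move=> v Lv; have LFv := fourier_L2 hF Lv; rewrite -(inner_fourier_inv hF)//.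
have [ri ii] := cintegrable_inner LFu LFv.
have [gri gii] := cintegrable_inner Lw LFv.
have mD : measurable (`]0%R, +oo[%classic : set (measurableTypeR R)) by exact: measurable_itv.
have g0 (xi : T) : ~ (`]0%R, +oo[%classic : set R) (sqenorm xi) -> symb (sqenorm xi) = 0.
  exact: sym0.
have rE xi : complex.Re (rmul fsymb (F u) xi * (F v xi)^*) =
    symb (sqenorm xi) * complex.Re (F u xi * (F v xi)^*).
  by rewrite /rmul -mulrA cReM /= mul0r subr0 fsymE.
have iE xi : complex.Im (rmul fsymb (F u) xi * (F v xi)^*) =
    symb (sqenorm xi) * complex.Im (F u xi * (F v xi)^*).
  by rewrite /rmul -mulrA cImM /= mul0r addr0 fsymE.
have gri' := integrable_ext (fun xi => congr1 EFin (rE xi)) gri.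
have gii' := integrable_ext (fun xi => congr1 EFin (iE xi)) gii.
have [a [b [abB ia ib abE]]] := posneg_density measurable_sqenorm mD msym g0 ri gri'.
have [c [d [cdB ic id cdE]]] := posneg_density measurable_sqenorm mD msym g0 ii gii'.
exists a, b, c, d; split => //.
- move=> B mB; rewrite (spec_form_fourier hF hE mB Lu Lv) abB// cdB//.
  apply: complexP; apply: eq_Rintegral => xi _.
    by rewrite /rmul -mulrA cReM /= mul0r subr0.
  by rewrite /rmul -mulrA cImM /= mul0r addr0.
- rewrite abE cdE; apply: complexP; apply: eq_Rintegral => xi _.
    by rewrite rE.
  by rewrite iE.
Qed.

(** For each v, <w, v> and <w', v> are integrals for the same set function, possibly through
    different decompositions; [has_cintegral_uniq] identifies them. *)
Lemma fraclog_unique u w w' : fraclog E s u w -> fraclog E s u w' -> ae_equal w w'.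
Proof.
move=> [_ [_ Lw hw]] [_ [_ Lw' hw']]; apply: inner_ext => // v Lv.
exact: has_cintegral_uniq (hw _ Lv) (hw' _ Lv).
Qed.

Lemma sqnorm_fraclog u w : fraclog E s u w -> sqnorm w = sqnorm (rmul fsymb (F u)).
Proof.
move=> huw; have [Hu [_ Lw _]] := huw; have Lf := H_fraclog_L2 Hu.
have Liv := fourier_inv_L2 hF Lf.
rewrite (sqnorm_ae _ _ (fraclog_unique huw (fraclog_Finv Hu))); try exact: L2_cmeasurable.
rewrite -(sqnorm_fourier hF)//; apply: sqnorm_ae; last exact: (fourierVK hF).
  exact/L2_cmeasurable/(fourier_L2 hF).
exact: L2_cmeasurable.
Qed.

End fraclog.

(** As [fraclog] is a relation, well-definedness splits into existence of a value and its uniqueness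
    almost everywhere. *)
Theorem theorem1p2 (R : realType) (n : nat) (s : R)
    (E : set R -> ('rV[R]_n -> R[i]) -> 'rV[R]_n -> R[i])
    (F Finv : ('rV[R]_n -> R[i]) -> 'rV[R]_n -> R[i]) :
  (0 < n)%N -> 0 < s ->
  spectral_resolution E -> unitary_fourier F Finv ->
  (H_fraclog E s =
    [set u | L2 u /\
      (\int[leb n]_xi (enorm xi `^ (4 * s) * ln (enorm xi ^+ 2) ^+ 2 *
         Normc.normc (F u xi) ^+ 2)%:E < +oo)%E]) /\
  (forall u, H_fraclog E s u ->
    [/\ exists w, fraclog E s u w,
        forall w w', fraclog E s u w -> fraclog E s u w' -> ae_equal w w',
        L2 (fun xi => (enorm xi `^ (2 * s) * ln (enorm xi ^+ 2))%:C * F u xi),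
        forall w, fraclog E s u w -> ae_equal w
          (Finv (fun xi =>
             (enorm xi `^ (2 * s) * ln (enorm xi ^+ 2))%:C * F u xi)) &
        forall w, fraclog E s u w -> sqnorm w =
          (\int[leb n]_xi (enorm xi `^ (4 * s) * ln (enorm xi ^+ 2) ^+ 2 *
             Normc.normc (F u xi) ^+ 2)%:E)%E]).
Proof.
move=> _ _ hE hF; split; first exact: (H_fraclogE s hF hE).
move=> u Hu; have Hw := fraclog_Finv hF hE Hu; split.
- by eexists; exact: Hw.
- by move=> w w' h1 h2; exact: fraclog_unique h1 h2.
- exact: (H_fraclog_L2 hF hE Hu).
- by move=> w huw; exact: fraclog_unique huw Hw.
- move=> w huw; rewrite (sqnorm_fraclog hF hE huw).
  exact: sqnorm_symbolE.
Qed.
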